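(* Let $G=SL(2,\mathbb R)$, $\Gamma=SL(2,\mathbb Z)$, $\epsilon\in(0,\frac{\pi}{6})$, and let $f\in L^2(G/\Gamma)$, viewed as a right $\Gamma$-invariant function on $G$. Then $$\int_{-\epsilon}^{\epsilon} \int_{-1/\epsilon}^{1/\epsilon} \int_{0}^{\infty} |f(k_{\theta} n_{T} a)|^2 \,\frac{d a}{a}\, d T\, d \theta \;\geq\; \| f\|_{L^2}^2.$$
   Context: Here $k_\theta=\begin{pmatrix}\cos\theta & -\sin\theta\\ \sin\theta & \cos\theta\end{pmatrix}$, $n_T=\begin{pmatrix}1&T\\0&1\end{pmatrix}$, $a=\begin{pmatrix}a&0\\0&a^{-1}\end{pmatrix}$ with $a>0$, so that $g=k_\theta n_T a$ is the $KNA$ Iwasawa decomposition of $g\in G$; $\frac{da}{a}\,dT\,d\theta$ is a $G$-invariant (Haar) measure on $G$ in these coordinates. $\|f\|_{L^2}^2=\int_{G/\Gamma}|f|^2$ with respect to the measure on $G/\Gamma$ induced by this Haar measure (equivalently, the integral of $|f|^2$ against $\frac{da}{a}dT\,d\theta$ over a measurable fundamental domain for the right action of $\Gamma$ on $G$). *)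

(* Defs.v *)
From HB Require Import structures.
From mathcomp Require Import all_boot all_order all_algebra.
From mathcomp Require Import all_classical all_reals all_analysis.
From mathcomp Require Import measurable_realfun.
From mathcomp Require Import complex ring.

Set Implicit Arguments.
Unset Strict Implicit.
Unset Printing Implicit Defensive.

Import Order.TTheory GRing.Theory Num.Theory.
Import numFieldNormedType.Exports.

Local Open Scope classical_set_scope.
Local Open Scope ring_scope.

Record SL2 (R : realType) := MkSL2 {
  sl2_mx :> 'M[R]_2;
  sl2_detP : \det sl2_mx == 1 }.

HB.instance Definition _ (R : realType) := [isSub for @sl2_mx R].
HB.instance Definition _ (R : realType) := [Choice of SL2 R by <:].

Section SL2_group.
Variable R : realType.
Implicit Types g h : SL2 R.

Lemma sl2_det g : \det (sl2_mx g) = 1.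
Proof. exact/eqP/sl2_detP. Qed.

Lemma sl2_unit g : sl2_mx g \in unitmx.
Proof. by rewrite unitmxE sl2_det unitr1. Qed.

Fact sl2_one_subproof : \det (1%:M : 'M[R]_2) == 1.
Proof. by rewrite det1. Qed.

Fact sl2_mul_subproof g h : \det (sl2_mx g *m sl2_mx h) == 1.
Proof. by rewrite det_mulmx !sl2_det mulr1. Qed.

Fact sl2_inv_subproof g : \det (invmx (sl2_mx g)) == 1.
Proof. by rewrite det_inv sl2_det invr1. Qed.

Definition sl2_one : SL2 R := MkSL2 sl2_one_subproof.
Definition sl2_mul g h : SL2 R := MkSL2 (sl2_mul_subproof g h).
Definition sl2_inv g : SL2 R := MkSL2 (sl2_inv_subproof g).

Fact sl2_mulA : associative sl2_mul.
Proof. by move=> x y z; apply: val_inj; exact: mulmxA. Qed.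

Fact sl2_mul1g : left_id sl2_one sl2_mul.
Proof. by move=> x; apply: val_inj; exact: mul1mx. Qed.

Fact sl2_mulg1 : right_id sl2_one sl2_mul.
Proof. by move=> x; apply: val_inj; exact: mulmx1. Qed.

Fact sl2_mulVg : left_inverse sl2_one sl2_inv sl2_mul.
Proof. by move=> x; apply: val_inj; apply: mulVmx; exact: sl2_unit. Qed.

Fact sl2_mulgV : right_inverse sl2_one sl2_inv sl2_mul.
Proof. by move=> x; apply: val_inj; apply: mulmxV; exact: sl2_unit. Qed.

HB.instance Definition _ := isGroup.Build (SL2 R)
  sl2_mulA sl2_mul1g sl2_mulg1 sl2_mulVg sl2_mulgV.

HB.instance Definition _ := isPointed.Build (SL2 R) sl2_one.

(* SL2 carries the subspace topology of the 2 x 2 matrices, and the Borel sets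
   of that topology. *)
HB.instance Definition _ :=
  Topological.copy (SL2 R) (initial_topology (@sl2_mx R)).

HB.instance Definition _ := Measurable.copy (SL2 R)
  (g_sigma_algebraType (@open (SL2 R))).

End SL2_group.

Section Iwasawa.
Variable R : realType.

Definition mx22 (a b c d : R) : 'M[R]_2 :=
  \matrix_(i, j) (if i == 0 then (if j == 0 then a else b)
                  else (if j == 0 then c else d)).

Lemma det_mx22 (a b c d : R) : \det (mx22 a b c d) = a * d - b * c.
Proof.
rewrite (expand_det_row _ ord0) !big_ord_recl big_ord0 addr0 /cofactor.
by rewrite !det_mx11 !mxE/= expr0 expr1 mul1r mulN1r mulrN.
Qed.

Fact rot_subproof (t : R) : \det (mx22 (cos t) (- sin t) (sin t) (cos t)) == 1.
Proof. by rewrite det_mx22 mulNr opprK -!expr2 cos2Dsin2. Qed.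

Definition rot (t : R) : SL2 R := MkSL2 (rot_subproof t).

Fact unip_subproof (T : R) : \det (mx22 1 T 0 1) == 1.
Proof. by rewrite det_mx22 mulr0 subr0 mulr1. Qed.

Definition unip (T : R) : SL2 R := MkSL2 (unip_subproof T).

(* Only used for a > 0; as a total function it takes the junk value 1 at a = 0,
   where the matrix is not in SL2. *)
Definition dilat (a : R) : SL2 R := insubd (1%g : SL2 R) (mx22 a 0 0 a^-1).

Lemma dilatE (a : R) : a != 0 -> dilat a = mx22 a 0 0 a^-1 :> 'M[R]_2.
Proof.
move=> a0; rewrite /dilat -[LHS]/(val _) insubdK// unfold_in.
by rewrite det_mx22 mulr0 subr0 divff.
Qed.

Definition kna (t T a : R) : SL2 R := (rot t * unip T * dilat a)%g.

(* The coordinates (theta, T, a); restricted to iwasawa_dom, which takes one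
   theta in each class modulo 2 pi, this is a bijection onto SL2. *)
Definition iwasawa (x : R * R * R) : SL2 R := kna x.1.1 x.1.2 x.2.

Definition iwasawa_dom : set (R * R * R) :=
  [set x | - pi < x.1.1 <= pi /\ 0 < x.2].

Lemma knaE (t T a : R) : 0 < a -> kna t T a = mx22
  (a * cos t) (a^-1 * (T * cos t - sin t))
  (a * sin t) (a^-1 * (T * sin t + cos t)) :> 'M[R]_2.
Proof.
move=> a0; have -> : kna t T a = mx22 (cos t) (- sin t) (sin t) (cos t) *m
    mx22 1 T 0 1 *m mx22 a 0 0 a^-1 :> 'M[R]_2.
  by rewrite -dilatE ?gt_eqF.
apply/matrixP => i j; rewrite !mxE !big_ord_recl !big_ord0 !mxE /=.
rewrite !big_ord_recl !big_ord0 !mxE /=.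
by case: i j => -[|[|i]]// i2 [[|[|j]]//= j2]; ring.
Qed.

Lemma measurable_mx d (T : measurableType d) (D : set T) (h : T -> 'M[R]_2)
    (V : set 'M[R]_2) :
  measurable D -> (forall i j, measurable_fun D (fun x => h x i j)) ->
  open V -> measurable (D `&` h @^-1` V).
Proof.
move=> mD mh oV.
pose q2r : 'M[rat]_2 -> 'M[R]_2 := map_mx ratr.
pose e (n : nat) : R := n.+1%:R^-1.
pose B (p : 'M[rat]_2 * nat) := \bigcap_i \bigcap_j
  (D `&` (fun x => h x i j) @^-1` ball (q2r p.1 i j) (e p.2)).
pose good (p : 'M[rat]_2 * nat) := ball (q2r p.1) (e p.2) `<=` V.
have e0 n : 0 < e n by rewrite invr_gt0 ltr0n.
have -> : D `&` h @^-1` V = \bigcup_p (if `[< good p >] then B p else set0).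
  apply/seteqP; split => x.
    move=> [Dx Vhx]; have /nbhs_ballP[r /= r0 rV] : nbhs (h x) V.
      by apply: open_nbhs_nbhs; split.
    have r20 : 0 < r / 2 by rewrite divr_gt0.
    have [n _ /(_ n (leqnn n)) nr] := near_infty_natSinv_lt (PosNum r20).
    have close i j : exists q : rat, ratr q \in `](h x i j - e n), (h x i j + e n)[.
      by apply: rat_in_itvoo; rewrite (@lt_trans _ _ (h x i j))// ?gtrBl ?ltrDl.
    pose q := \matrix_(i, j) projT1 (cid (close i j)).
    have qx i j : ball (q2r q i j) (e n) (h x i j).
      rewrite !mxE; case: (cid (close i j)) => /= s.
      by rewrite in_itv/= -ltr_distl /ball/=.
    exists (q, n) => //=; rewrite asboolT; last first.
      move=> M qM; apply: rV; apply: (@ball_splitr _ _ (q2r q)).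
        by split => // i j; apply: le_ball (qx i j); exact: ltW.
      by apply: le_ball qM; exact: ltW.
    by move=> i _ j _; split => //; exact: qx.
  move=> [p _]; case: ifPn => // /asboolP gp Bp.
  have hx i j : ball (q2r p.1 i j) (e p.2) (h x i j) by have [] := Bp i I j I.
  by split; [have [] := Bp 0 I 0 I | apply: gp; split].
apply: countable_bigcupT_measurable; first exact: countableP.
move=> p; case: ifPn => _; last exact: measurable0.
apply: fin_bigcap_measurable => [|i _]; first exact: finite_finset.
apply: fin_bigcap_measurable => [|j _]; first exact: finite_finset.
by apply: mh => //; exact: measurable_ball.
Qed.

Lemma measurable_iwasawa_dom : measurable iwasawa_dom.
Proof.
rewrite (_ : iwasawa_dom =
    (`](- pi), pi] `*` [set: R]) `*` `]0, +oo[%classic); last first.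
  apply/seteqP; split => -[[t T] a] /=; rewrite !in_itv/= ?andbT.
    by move=> [].
  by move=> [[]].
by apply: measurableX => //; apply: measurableX.
Qed.

Lemma measurable_inv_iwasawa :
  measurable_fun iwasawa_dom (fun x : R * R * R => x.2^-1).
Proof.
have mcomp := measurable_comp (F := (`]0, +oo[%classic : set R))
  (f := fun a : R => a^-1) (g := (snd : R * R * R -> R)) (E := iwasawa_dom).
apply: mcomp => //.
- by move=> _ [x [_ x0] <-] /=; rewrite in_itv/= x0.
- apply: open_continuous_measurable_fun; first exact: interval_open.
  move=> a; rewrite inE/= in_itv/= andbT => a0.
  by apply: inv_continuous; rewrite gt_eqF.
- exact: measurable_funTS.
Qed.

Lemma measurable_iwasawa : measurable_fun iwasawa_dom iwasawa.
Proof.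
have mD := measurable_iwasawa_dom.
apply: (@measurability _ _ _ _ _ _ (@open (SL2 R))) => //.
move=> _ [U oU <-]; have [V oV <-] := oU.
rewrite -[X in _ `&` X]/((fun x => sl2_mx (iwasawa x)) @^-1` V).
apply: measurable_mx => // i j.
have mt : measurable_fun iwasawa_dom (fun x : R * R * R => x.1.1).
  apply: measurable_funTS.
  by apply: (measurableT_comp (f := fst)) => //; exact: measurable_fst.
have mT : measurable_fun iwasawa_dom (fun x : R * R * R => x.1.2).
  apply: measurable_funTS.
  by apply: (measurableT_comp (f := snd)) => //; exact: measurable_fst.
have ma : measurable_fun iwasawa_dom (fun x : R * R * R => x.2).
  by apply: measurable_funTS; exact: measurable_snd.
have mc : measurable_fun iwasawa_dom (fun x : R * R * R => cos x.1.1).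
  apply: (measurableT_comp (f := cos)) => //.
  by apply: continuous_measurable_fun; exact: continuous_cos.
have ms : measurable_fun iwasawa_dom (fun x : R * R * R => sin x.1.1).
  apply: (measurableT_comp (f := sin)) => //.
  by apply: continuous_measurable_fun; exact: continuous_sin.
have mi := measurable_inv_iwasawa.
apply: (@eq_measurable_fun _ _ _ _ _ (fun x : R * R * R => mx22
  (x.2 * cos x.1.1) (x.2^-1 * (x.1.2 * cos x.1.1 - sin x.1.1))
  (x.2 * sin x.1.1) (x.2^-1 * (x.1.2 * sin x.1.1 + cos x.1.1)) i j)).
  by move=> x; rewrite inE => -[_ x0]; rewrite /iwasawa knaE.
case: i j => -[|[|i]]// i2 [[|[|j]]//= j2];
  under eq_fun do rewrite mxE/=; repeat
  first [exact: mi | exact: mc | exact: ms | exact: mT | exact: ma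
       | apply: measurable_funM | apply: measurable_funB
       | apply: measurable_funD].
Qed.

(* da/a dT dtheta, transported to SL2. *)
Definition haar (A : set (SL2 R)) : \bar R :=
  (\int[(@lebesgue_measure R \x @lebesgue_measure R) \x @lebesgue_measure R]_(x
      in iwasawa_dom `&` iwasawa @^-1` A) (x.2^-1)%:E)%E.

Lemma haar0 : haar set0 = 0%E.
Proof. by rewrite /haar preimage_set0 setI0 integral_set0. Qed.

Lemma haar_ge0 A : (0 <= haar A)%E.
Proof.
apply: integral_ge0 => x [[_ x0] _].
by rewrite lee_fin invr_ge0 ltW.
Qed.

Lemma haar_semi_sigma_additive : semi_sigma_additive haar.
Proof.
move=> F mF tF mUF.
rewrite /haar preimage_bigcup setI_bigcupr ge0_integral_bigcup//=.
- apply: is_cvg_ereal_nneg_natsum_cond => n _ _; exact: haar_ge0.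
- by move=> k; apply: measurable_iwasawa => //; exact: measurable_iwasawa_dom.
- apply/measurable_EFinP; apply: measurable_funS measurable_inv_iwasawa.
    exact: measurable_iwasawa_dom.
  by move=> x [n _ []].
- by move=> x [n _ [[_ x0] _]]; rewrite lee_fin invr_ge0 ltW.
- apply/trivIsetP => i j _ _ ij; move/trivIsetP: tF => /(_ i j Logic.I Logic.I ij).
  rewrite -subset0 => ijF; rewrite -subset0 => x [[_ Fi] [_ Fj]].
  exact: (ijF (iwasawa x)).
Qed.

HB.instance Definition _ := isMeasure.Build _ (SL2 R) R haar
  haar0 haar_ge0 haar_semi_sigma_additive.

End Iwasawa.

Section quotient_L2.
Variable R : realType.
Implicit Types (F : set (SL2 R)) (f : SL2 R -> R[i]).

Definition SL2Z : set (SL2 R) :=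
  [set g | forall i j, sl2_mx g i j \is a Num.int].

(* Measurable fundamental domain for the right action of SL2Z, up to null sets:
   almost every orbit meets F, and almost every point of F is the only point of
   its orbit in F.  A measurable set of orbit representatives is a special
   case. *)
Definition fundamental_domain F : Prop :=
  [/\ measurable F,
      {ae haar (R := R), forall g : SL2 R,
        exists2 y : SL2 R, SL2Z y & F (g * y)%g} &
      forall y : SL2 R, SL2Z y -> y <> 1%g ->
        (haar (R := R)).-negligible (F `&` [set g | F (g * y)%g])].

Definition normsq (z : R[i]) : R := ComplexField.Normc.normc z ^+ 2.

(* For right SL2Z-invariant f this does not depend on the fundamental domain F:
   it is the integral of |f|^2 over SL2 / SL2Z for the measure induced by haar. *)
Definition L2normsq F f : \bar R :=
  (\int[haar (R := R)]_(g in F) (normsq (f g))%:E)%E.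

(* f is (the lift to SL2 of) an element of L^2(SL2 / SL2Z), with Borel
   measurability of a complex function checked on real and imaginary parts. *)
Definition L2_quotient F f : Prop :=
  [/\ measurable_fun setT (fun g => complex.Re (f g)),
      measurable_fun setT (fun g => complex.Im (f g)),
      forall g y : SL2 R, SL2Z y -> f (g * y)%g = f g &
      (L2normsq F f < +oo)%E].

End quotient_L2.

(* Main.v *)
Require Import Defs.
From HB Require Import structures.
From mathcomp Require Import all_boot all_order all_algebra.
From mathcomp Require Import all_classical all_reals all_analysis.
From mathcomp Require Import measurable_realfun.
From mathcomp Require Import complex.
From mathcomp Require Import ring lra zify.

(* A point g of SL2(R) is seen as the basis of the unimodular lattice g Z^2
   given by its columns, and g = k_theta n_T a means that the first column u has
   argument theta and that u.v = T, where v is the second one.  It suffices that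
   every g has a translate g y, y in SL2(Z), in the region
   |theta| <= eps, |T| <= 1/eps: as SL2(Z) preserves haar, F can then be cut into
   countably many pieces whose translates lie in that region and do not overlap.
   So every unimodular lattice needs a basis (u, v) with u within angle eps of
   the positive x-axis and |u.v| <= 1/eps.  Start from a reduced basis.  If none
   of u, v, -u, -v is in the sector, then the sector lies in one of the cones
   they span; apply Farey subdivision to that cone.  Each step raises u.v by at
   least the squared length of a shortest vector, while u.v is the cotangent of
   the angle of a cone of opening at least 2 eps.  So at some point m = u + v is
   in the sector; then one of the angles from u to m and from m to v
   is at least eps, and completing m by that neighbour gives |T| <= 1/eps. *)

Set Implicit Arguments.
Unset Strict Implicit.
Unset Printing Implicit Defensive.

Import Order.TTheory GRing.Theory Num.Theory.
Import numFieldNormedType.Exports.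

Local Open Scope classical_set_scope.
Local Open Scope ring_scope.

(** * Farey subdivision of plane lattice bases *)

Section Farey.
Variables (R : archiRealFieldType) (c s : R).
Hypotheses (s_gt0 : 0 < s) (lt_sc : s < c).

(** For [c] and [s] proportional to [cos eps] and [sin eps] this is the closed sector of half-angle
    eps about the positive x-axis; the two inequalities together force [0 <= x]. *)
Definition in_cone (x y : R) := (c * y <= s * x) && (- (s * x) <= c * y).

(** The four quantities are the determinants of [u] and [v] with the edge vectors [(c, -s)] and
    [(c, s)] of the sector: [u] is below both edge lines and [v] above both. *)
Definition straddle (ux uy vx vy : R) : Prop :=
  [/\ 0 < - (s * ux) - c * uy, 0 < s * ux - c * uy,
      0 < c * vy + s * vx & 0 < c * vy - s * vx].

(** The edge vectors are positive combinations of [u] and [v], so the angle from [u] to [v] exceeds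
    the opening of the sector. The determinants of the two pairs are 1 and [2 * c * s], and the
    inequality compares the cotangents of the two angles. *)
Lemma straddle_cot (ux uy vx vy : R) :
  ux * vy - uy * vx = 1 -> straddle ux uy vx vy ->
  2 * c * s * (ux * vx + uy * vy) < c ^+ 2 - s ^+ 2.
Proof.
move=> d1 [].
set b := - (s * ux) - c * uy; set b' := s * ux - c * uy.
set a := c * vy + s * vx; set a' := c * vy - s * vx => b0 b'0 a0 a'0.
have [sg|sg] := ltP (ux * vx + uy * vy) 0.
  apply: (@lt_trans _ _ 0).
    by rewrite nmulr_llt0// !mulr_gt0// (lt_trans s_gt0).
  by rewrite subr_gt0 ltrXn2r//= ltW// (lt_trans s_gt0).
(* Cramer's rule: the coordinates of the edge vectors in the basis [(u, v)]. *)
have e1 : c = a * ux + b * vx by rewrite -[LHS]mulr1 -d1 /a /b; ring.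
have e2 : - s = a * uy + b * vy by rewrite -[LHS]mulr1 -d1 /a /b; ring.
have e3 : c = a' * ux + b' * vx by rewrite -[LHS]mulr1 -d1 /a' /b'; ring.
have e4 : s = a' * uy + b' * vy by rewrite -[LHS]mulr1 -d1 /a' /b'; ring.
have e5 : a * b' - a' * b = 2 * c * s.
  transitivity (2 * c * s * (ux * vy - uy * vx)); last by rewrite d1 mulr1.
  by rewrite /a /b /a' /b'; ring.
have e6 : c ^+ 2 - s ^+ 2 = a * a' * (ux ^+ 2 + uy ^+ 2)
   + (a * b' + a' * b) * (ux * vx + uy * vy) + b * b' * (vx ^+ 2 + vy ^+ 2).
  transitivity (c * c + (- s) * s); first by ring.
  by rewrite {1}e1 {1}e3 e2 {1}e4; ring.
rewrite -subr_gt0.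
have -> : c ^+ 2 - s ^+ 2 - 2 * c * s * (ux * vx + uy * vy) =
  a * a' * (ux ^+ 2 + uy ^+ 2) + 2 * (a' * b * (ux * vx + uy * vy))
    + b * b' * (vx ^+ 2 + vy ^+ 2).
  by rewrite e6 -e5; ring.
have u0 : 0 < ux ^+ 2 + uy ^+ 2.
  rewrite lt_neqAle addr_ge0 ?sqr_ge0// andbT eq_sym paddr_eq0 ?sqr_ge0//.
  rewrite !sqrf_eq0; apply/negP => /andP[/eqP u0 /eqP u1].
  by move: d1; rewrite u0 u1; lra.
apply: ltr_pwDl; first apply: ltr_pwDl.
- by rewrite !mulr_gt0.
- by rewrite mulr_ge0// mulr_ge0// mulr_ge0//; exact: ltW.
- by rewrite mulr_ge0 ?addr_ge0 ?sqr_ge0// mulr_ge0//; exact: ltW.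
Qed.

(* With X = u.m and Y = m.v for m = u + v, unimodularity reads
   X Y - (u.v) (X + Y) = 1, which is the addition formula for cot. *)
Lemma mediant_cot (M ux uy vx vy : R) :
  c <= M * s -> ux * vy - uy * vx = 1 ->
  2 * c * s * (ux * vx + uy * vy) < c ^+ 2 - s ^+ 2 ->
  ux * (ux + vx) + uy * (uy + vy) <= M \/ (ux + vx) * vx + (uy + vy) * vy <= M.
Proof.
move=> cM d1; set g := ux * vx + uy * vy => cot.
set X := ux * _ + _; set Y := (ux + vx) * _ + _.
have e : X * Y - g * (X + Y) = 1.
  transitivity ((ux * vy - uy * vx) ^+ 2); last by rewrite d1 expr1n.
  by rewrite /X /Y /g; ring.
have [|XM] := leP X M; [by left|right].
rewrite leNgt; apply/negP => YM.
have cX : c < X * s by apply: le_lt_trans cM _; rewrite ltr_pM2r.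
have cY : c < Y * s by apply: le_lt_trans cM _; rewrite ltr_pM2r.
have h0 : (X * s - c) * (Y * s - c) + c * (X * s - c) + c * (Y * s - c)
   = X * s * (Y * s) - c ^+ 2 by ring.
have c0 : 0 < c by apply: lt_trans lt_sc.
have q0 : 0 < X * s + Y * s by lra.
have h1 : 2 * c * (s * s) * (X * Y - g * (X + Y)) =
   2 * c * (X * s * (Y * s)) - (2 * c * s * g) * (X * s + Y * s) by ring.
rewrite e mulr1 in h1.
have h2 : (2 * c * s * g) * (X * s + Y * s) <
   (c ^+ 2 - s ^+ 2) * (X * s + Y * s) by rewrite ltr_pM2r.
(* In terms of the excesses [p] and [q] of [X * s] and [Y * s] over [c], [h1] and [h2] combine to
   [(c^2 + s^2) (p + q) + 2 c p q < 0], which is impossible. *)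
set p := X * s - c in h0; set q := Y * s - c in h0.
have p0 : 0 < p by rewrite /p; lra.
have q1 : 0 < q by rewrite /q; lra.
have Xp : X * s = c + p by rewrite /p; ring.
have Yp : Y * s = c + q by rewrite /q; ring.
rewrite Xp Yp in h1 h2.
have pD : 0 < p + q by rewrite addr_gt0.
have := mulr_gt0 (exprn_gt0 2 c0) pD; have := mulr_gt0 (exprn_gt0 2 s_gt0) pD.
have := mulr_gt0 c0 (mulr_gt0 p0 q1); lra.
Qed.

Section basis.
(** [P] stands for the oriented bases [(u, v)] of a fixed unimodular lattice, known only through
    their determinant and three elementary changes of basis. *)
Variable P : R -> R -> R -> R -> Prop.
Hypothesis P_det : forall ux uy vx vy, P ux uy vx vy -> ux * vy - uy * vx = 1.
Hypothesis P_addr : forall ux uy vx vy,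
  P ux uy vx vy -> P ux uy (ux + vx) (uy + vy).
Hypothesis P_addl : forall ux uy vx vy,
  P ux uy vx vy -> P (ux + vx) (uy + vy) vx vy.
Hypothesis P_rot : forall ux uy vx vy,
  P ux uy vx vy -> P vx vy (- ux) (- uy).

Definition good_basis (M : R) := exists ux uy vx vy,
  [/\ P ux uy vx vy, in_cone ux uy & `|ux * vx + uy * vy| <= M].

(* The last hypothesis says that at most n subdivision steps are possible. *)
Lemma farey (M l : R) (n : nat) (ux uy vx vy : R) :
  c <= M * s -> 0 < l -> P ux uy vx vy -> straddle ux uy vx vy ->
  l <= ux ^+ 2 + uy ^+ 2 -> l <= vx ^+ 2 + vy ^+ 2 ->
  - l <= 2 * (ux * vx + uy * vy) ->
  c ^+ 2 - s ^+ 2 - 2 * c * s * (ux * vx + uy * vy) <= n%:R * (2 * c * s * l) ->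
  good_basis M.
Proof.
move=> cM l0.
have c0 : 0 < c by apply: lt_trans lt_sc.
have M0 : 0 <= M.
  rewrite leNgt; apply/negP => M0.
  by have : M * s < 0 by [rewrite nmulr_rlt0]; lra.
have k0 : 0 < 2 * c * s by rewrite !mulr_gt0.
elim: n ux uy vx vy => [|n IH] ux uy vx vy Puv strad lu lv luv bound.
  (* With no subdivision step left, the bound contradicts [straddle_cot]. *)
  by have := straddle_cot (P_det Puv) strad; rewrite mul0r in bound; lra.
have cot := straddle_cot (P_det Puv) strad.
have d1 := P_det Puv.
rewrite -natr1 mulrDl mul1r in bound.
have lm : l <= (ux + vx) ^+ 2 + (uy + vy) ^+ 2.
  have -> : (ux + vx) ^+ 2 + (uy + vy) ^+ 2 = (ux ^+ 2 + uy ^+ 2)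
    + (vx ^+ 2 + vy ^+ 2) + 2 * (ux * vx + uy * vy) by ring.
  lra.
(* If the mediant is below the lower edge line it replaces [u]; if it is above the upper one it
   replaces [v]; otherwise it is in the sector. *)
have [m1|m1] := ltP 0 (- (s * (ux + vx)) - c * (uy + vy)).
  apply: (IH _ _ _ _ (P_addl Puv)) => //.
  - case: strad => b0 b'0 a0 a'0; split=> //.
    rewrite ltNge; apply/negP => m2.
    have : (c * vy + s * vx) * (s * (ux + vx) - c * (uy + vy)) <= 0.
      by rewrite mulr_ge0_le0 // ltW.
    (* The Pluecker relation between the two edge vectors, the mediant and [v]. It excludes a
       mediant below the lower line but not below the upper one, that is, one pointing backwards. *)
    have -> : (c * vy + s * vx) * (s * (ux + vx) - c * (uy + vy)) =
      2 * c * s * (ux * vy - uy * vx) +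
      (c * vy - s * vx) * (- (s * (ux + vx)) - c * (uy + vy)) by ring.
    rewrite d1 mulr1 leNgt; apply/negP/negPn/addr_gt0 => //.
    exact: mulr_gt0.
  - have -> : (ux + vx) * vx + (uy + vy) * vy =
      (ux * vx + uy * vy) + (vx ^+ 2 + vy ^+ 2) by ring.
    lra.
  - have -> : (ux + vx) * vx + (uy + vy) * vy =
      (ux * vx + uy * vy) + (vx ^+ 2 + vy ^+ 2) by ring.
    have : 2 * c * s * l <= 2 * c * s * (vx ^+ 2 + vy ^+ 2) by rewrite ler_pM2l.
    lra.
have [m2|m2] := ltP 0 (c * (uy + vy) - s * (ux + vx)).
  apply: (IH _ _ _ _ (P_addr Puv)) => //.
  - case: strad => b0 b'0 a0 a'0; split=> //.
    rewrite ltNge; apply/negP => m3.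
    have : (s * ux - c * uy) * (c * (uy + vy) + s * (ux + vx)) <= 0.
      by rewrite mulr_ge0_le0 // ltW.
    have -> : (s * ux - c * uy) * (c * (uy + vy) + s * (ux + vx)) =
      2 * c * s * (ux * vy - uy * vx) +
      (- (s * ux) - c * uy) * (c * (uy + vy) - s * (ux + vx)) by ring.
    rewrite d1 mulr1 leNgt; apply/negP/negPn/addr_gt0 => //.
    exact: mulr_gt0.
  - have -> : ux * (ux + vx) + uy * (uy + vy) =
      (ux * vx + uy * vy) + (ux ^+ 2 + uy ^+ 2) by ring.
    lra.
  - have -> : ux * (ux + vx) + uy * (uy + vy) =
      (ux * vx + uy * vy) + (ux ^+ 2 + uy ^+ 2) by ring.
    have : 2 * c * s * l <= 2 * c * s * (ux ^+ 2 + uy ^+ 2) by rewrite ler_pM2l.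
    lra.
have mC : in_cone (ux + vx) (uy + vy) by apply/andP; split; lra.
have X0 : 0 <= ux * (ux + vx) + uy * (uy + vy).
  have -> : ux * (ux + vx) + uy * (uy + vy) =
    (ux * vx + uy * vy) + (ux ^+ 2 + uy ^+ 2) by ring.
  lra.
have Y0 : 0 <= (ux + vx) * vx + (uy + vy) * vy.
  have -> : (ux + vx) * vx + (uy + vy) * vy =
    (ux * vx + uy * vy) + (vx ^+ 2 + vy ^+ 2) by ring.
  lra.
(* The mediant becomes the first vector; it is completed by [v], or by [- u] with the sign that
   keeps the determinant 1. *)
have [XM|YM] := mediant_cot cM d1 cot.
  exists (ux + vx), (uy + vy), (- ux), (- uy); split=> //.
    exact: P_rot (P_addr Puv).
  have -> : (ux + vx) * - ux + (uy + vy) * - uy =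
    - (ux * (ux + vx) + uy * (uy + vy)) by ring.
  by rewrite normrN ger0_norm.
exists (ux + vx), (uy + vy), vx, vy; split=> //; first exact: P_addl.
by rewrite ger0_norm.
Qed.

(** The two edge lines cut the plane into the sector, its opposite, and the two open regions of the
    conclusion. *)
Lemma cone_side (x y : R) : ~~ in_cone x y -> ~~ in_cone (- x) (- y) ->
  (0 < - (s * x) - c * y /\ 0 < s * x - c * y) \/
  (0 < c * y + s * x /\ 0 < c * y - s * x).
Proof.
rewrite /in_cone !negb_and -!ltNge !mulrN !opprK.
by case/orP=> h1; case/orP=> h2; (do [left; lra|right; lra|exfalso; lra]).
Qed.

(** Lagrange's identity [|u|^2 |v|^2 = 1 + (u.v)^2] and reducedness give [3 (u.v)^2 <= 1], so any of
    [u], [v], [-u], [-v] in the sector already heads a good basis. Otherwise each of [u] and [v] is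
    on one side of both edge lines, and one of the four quarter turns of the basis straddles the
    sector, where [farey] applies. *)
Lemma reduced_good_basis (M : R) (ux uy vx vy : R) :
  1 <= M -> c <= M * s -> P ux uy vx vy ->
  2 * `|ux * vx + uy * vy| <= ux ^+ 2 + uy ^+ 2 ->
  2 * `|ux * vx + uy * vy| <= vx ^+ 2 + vy ^+ 2 ->
  good_basis M.
Proof.
move=> M1 cM Puv redu redv.
have d1 := P_det Puv.
have n2 : (ux ^+ 2 + uy ^+ 2) * (vx ^+ 2 + vy ^+ 2) =
    1 + (ux * vx + uy * vy) ^+ 2.
  by transitivity ((ux * vy - uy * vx) ^+ 2 + (ux * vx + uy * vy) ^+ 2);
    [ring | rewrite d1 expr1n].
have gM : `|ux * vx + uy * vy| <= M.
  apply: le_trans M1; rewrite -(ler_pXn2r (ltn0Sn 1)) ?nnegrE// expr1n.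
  have g0 := normr_ge0 (ux * vx + uy * vy).
  have := ler_pM (mulr_ge0 (ler0n _ _) g0) (mulr_ge0 (ler0n _ _) g0) redu redv.
  rewrite n2 -[(ux * vx + _) ^+ 2]real_normK ?num_real//; lra.
have P1 := P_rot Puv; have P2 := P_rot P1; have P3 := P_rot P2.
rewrite !opprK in P2 P3.
have [|u1] := boolP (in_cone ux uy); first by exists ux, uy, vx, vy.
have [|u2] := boolP (in_cone (- ux) (- uy)).
  by exists (- ux), (- uy), (- vx), (- vy); split=> //; rewrite !mulrNN.
have [|v1] := boolP (in_cone vx vy).
  exists vx, vy, (- ux), (- uy); split=> //.
  by rewrite !mulrN -opprD normrN mulrC [vy * _]mulrC.
have [|v2] := boolP (in_cone (- vx) (- vy)).
  exists (- vx), (- vy), ux, uy; split=> //.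
  by rewrite !mulNr -opprD normrN mulrC [vy * _]mulrC.
have n2_gt0 : 0 < (ux ^+ 2 + uy ^+ 2) * (vx ^+ 2 + vy ^+ 2).
  by rewrite n2 ltr_pwDl ?sqr_ge0.
have u0 : 0 < ux ^+ 2 + uy ^+ 2.
  rewrite lt0r addr_ge0 ?sqr_ge0// andbT.
  by apply: contraTneq n2_gt0 => ->; rewrite mul0r ltxx.
have v0 : 0 < vx ^+ 2 + vy ^+ 2.
  rewrite lt0r addr_ge0 ?sqr_ge0// andbT.
  by apply: contraTneq n2_gt0 => ->; rewrite mulr0 ltxx.
pose l := Num.min (ux ^+ 2 + uy ^+ 2) (vx ^+ 2 + vy ^+ 2).
have l0 : 0 < l by rewrite lt_min u0.
have lu : l <= ux ^+ 2 + uy ^+ 2 by rewrite ge_min lexx.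
have lv : l <= vx ^+ 2 + vy ^+ 2 by rewrite ge_min lexx orbT.
have gl : 2 * `|ux * vx + uy * vy| <= l by rewrite le_min redu.
have c0 : 0 < c by apply: lt_trans lt_sc.
(* Quarter turns permute the two lengths and change [u.v] at most by a sign, so one argument serves
   all four. *)
have start wx wy zx zy : P wx wy zx zy -> straddle wx wy zx zy ->
    l <= wx ^+ 2 + wy ^+ 2 -> l <= zx ^+ 2 + zy ^+ 2 ->
    `|wx * zx + wy * zy| <= `|ux * vx + uy * vy| -> good_basis M.
  move=> Pwz strad lw lz gw.
  pose K := c ^+ 2 - s ^+ 2 - 2 * c * s * (wx * zx + wy * zy).
  have k0 : 0 < 2 * c * s * l by rewrite !mulr_gt0.
  (* Every subdivision lowers [K] by at least [2 * c * s * l], which bounds their number. *)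
  apply: (@farey M l (Num.bound (K / (2 * c * s * l))) wx wy zx zy) => //.
    have := ler_norm (- (wx * zx + wy * zy)); rewrite normrN; lra.
  rewrite -ler_pdivrMr//; apply/ltW/archi_boundP/divr_ge0; last exact: ltW.
  by rewrite subr_ge0 ltW // straddle_cot // P_det.
have vu t z w y : (t * w + z * y : R) = w * t + y * z by ring.
have [[b0 b'0]|[b0 b'0]] := cone_side u1 u2;
  have [[a0 a'0]|[a0 a'0]] := cone_side v1 v2.
- apply: (start _ _ _ _ P1); rewrite ?sqrrN//; first by split; lra.
  by rewrite !mulrN -opprD normrN vu.
- by apply: (start _ _ _ _ Puv) => //; split; lra.
- apply: (start _ _ _ _ P2); rewrite ?sqrrN ?mulrNN//; first by split; lra.
- apply: (start _ _ _ _ P3); rewrite ?sqrrN//; first by split; lra.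
  by rewrite !mulNr -opprD normrN vu.
Qed.

(** A basis minimizing [|u|^2 + |v|^2] is reduced: compare it with [(u, u + v)], [(u + v, v)],
    [(u, v - u)] and [(u - v, v)]. *)
Lemma minimal_good_basis (M : R) (ux uy vx vy : R) :
  1 <= M -> c <= M * s -> P ux uy vx vy ->
  (forall wx wy zx zy, P wx wy zx zy ->
    ux ^+ 2 + uy ^+ 2 + (vx ^+ 2 + vy ^+ 2) <=
    wx ^+ 2 + wy ^+ 2 + (zx ^+ 2 + zy ^+ 2)) ->
  good_basis M.
Proof.
move=> M1 cM Puv min.
(* The quarter turn has order four, so its cube is its inverse. *)
have P3 a b a' b' : P a b a' b' -> P (- a') (- b') a b.
  by move=> /P_rot/P_rot/P_rot; rewrite !opprK.
have h1 := min _ _ _ _ (P_addr Puv).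
have h2 := min _ _ _ _ (P_addl Puv).
have h3 := min _ _ _ _ (P3 _ _ _ _ (P_addl (P_rot Puv))).
have h4 := min _ _ _ _ (P3 _ _ _ _ (P_addr (P_rot Puv))).
apply: (reduced_good_basis M1 cM Puv).
  rewrite -lter_pdivlMl// ler_norml; apply/andP; split; lra.
rewrite -lter_pdivlMl// ler_norml; apply/andP; split; lra.
Qed.

End basis.
End Farey.

(** * Densities and integrals on the line *)

Section density.
Import HBNNSimple.
Local Open Scope ereal_scope.

(** [mu] is the image under [h] of the measure with density [w]. The formula is checked on simple
    functions and passes to the limit by monotone convergence. It serves both for [haar] and for the
    substitution [a = expR s]. *)
Lemma ge0_integral_density d1 d2 (X : measurableType d1) (Y : measurableType d2)
    (R : realType) (m : {measure set X -> \bar R}) (D : set X) (h : X -> Y)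
    (w : X -> R) (mu : {measure set Y -> \bar R}) :
  measurable D -> measurable_fun D h -> measurable_fun D w ->
  (forall x, D x -> (0 <= w x)%R) ->
  (forall A, measurable A -> mu A = \int[m]_(x in D `&` h @^-1` A) (w x)%:E) ->
  forall phi : Y -> \bar R, measurable_fun setT phi -> (forall y, 0 <= phi y) ->
  \int[mu]_y phi y = \int[m]_(x in D) (phi (h x) * (w x)%:E).
Proof.
move=> mD mh mw w0 muE phi mphi phi0.
have mw' : measurable_fun D (EFin \o w) by exact/measurable_EFinP.
pose g := nnsfun_approx measurableT mphi.
have simple n : \int[mu]_y (g n y)%:E = \int[m]_(x in D) ((g n (h x))%:E * (w x)%:E).
  have mA r : measurable (g n @^-1` [set r]) by exact: measurable_sfunP.
  pose B r := D `&` h @^-1` (g n @^-1` [set r]).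
  have mB r : measurable (B r) by exact: mh.
  have termE r x : D x -> (r * \1_(g n @^-1` [set r]) (h x))%:E * (w x)%:E =
      r%:E * ((EFin \o w) \_ (B r)) x.
    move=> Dx; rewrite EFinM -muleA; congr (_ * _).
    rewrite patchE indicE in_setI (mem_set Dx) /=.
    by rewrite -[h x \in _]/(x \in h @^-1` _); case: ifPn; rewrite ?mul1e ?mul0e.
  have mpatch r : measurable_fun D ((EFin \o w) \_ (B r)).
    apply/measurable_restrict => //.
    by apply: measurable_funS mw' => // x [].
  have patch0 r x : D x -> 0 <= ((EFin \o w) \_ (B r)) x.
    by move=> Dx; rewrite patchE; case: ifPn => //=; rewrite lee_fin w0.
  rewrite integralT_nnsfun sintegralE.
  under [RHS]eq_integral => x /[!inE] Dx.
    rewrite (fimfunE (g n) (h x)) -fsumEFin// ge0_mule_fsuml; last first.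
      by move=> r; rewrite EFinM nnfun_muleindic_ge0.
    over.
  rewrite ge0_integral_fsum//.
  - apply: eq_fsbigr => r /set_mem[y _ ry].
    have BD : D `&` B r = B r by rewrite /B setIA setIid.
    rewrite muE// -/(B r) -BD integral_mkcondr -ge0_integralZl//.
    + by apply: eq_integral => x /[!inE] Dx; rewrite termE.
    + exact: patch0.
    + by rewrite lee_fin -ry.
  - move=> r; apply: (eq_measurable_fun (fun x => r%:E * ((EFin \o w) \_ (B r)) x)).
      by move=> x /[!inE] Dx; rewrite termE.
    exact: emeasurable_funM.
  - move=> r x Dx; rewrite mule_ge0 ?lee_fin ?w0//.
    by rewrite -lee_fin EFinM nnfun_muleindic_ge0.
transitivity (limn (fun n => \int[mu]_y (g n y)%:E)).
  rewrite -monotone_convergence//.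
  - apply: eq_integral => y _; apply/esym/cvg_lim => //.
    by apply: cvg_nnsfun_approx => //.
  - by move=> n; exact/measurable_EFinP/measurable_funP.
  - by move=> n y _; rewrite lee_fin.
  - by move=> y _ i j ij; rewrite lee_fin; exact/lefP/nd_nnsfun_approx.
under eq_fun do rewrite simple.
have mgh n : measurable_fun D (fun x => (g n (h x))%:E).
  by apply/measurable_EFinP; apply: (measurableT_comp (f := g n)).
rewrite -monotone_convergence//.
- apply: eq_integral => x /[!inE] Dx; apply/cvg_lim => //.
  apply: cvgeZr => //.
  by apply: cvg_nnsfun_approx.
- by move=> n; apply: emeasurable_funM.
- by move=> n x Dx; rewrite mule_ge0 ?lee_fin ?w0.
- move=> x Dx i j ij; rewrite lee_wpmul2r ?lee_fin ?w0//.
  exact/lefP/nd_nnsfun_approx.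
Qed.
End density.

(** This makes the image of da/a under [ln] a measure, to which the uniqueness of Lebesgue measure
    can be applied. *)
Lemma density_sigma_additive d1 d2 (X : measurableType d1) (Y : measurableType d2)
    (R : realType) (m : {measure set X -> \bar R}) (D : set X) (h : X -> Y)
    (w : X -> R) :
  measurable D -> measurable_fun D h -> measurable_fun D w ->
  (forall x, D x -> 0 <= w x) ->
  semi_sigma_additive
    (fun A => \int[m]_(x in D `&` h @^-1` A) (w x)%:E)%E.
Proof.
move=> mD mh mw w0 F mF tF mUF.
have w0' A : forall x, (D `&` h @^-1` A) x -> (0 <= (w x)%:E)%E.
  by move=> x [Dx _]; rewrite lee_fin w0.
rewrite preimage_bigcup setI_bigcupr ge0_integral_bigcup//=.
- by apply: is_cvg_ereal_nneg_natsum_cond => n _ _; exact/integral_ge0/w0'.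
- by move=> k; exact: mh.
- by apply/measurable_EFinP; apply: measurable_funS mw => // x [n _ []].
- by move=> x [n _ [Dx _]]; rewrite lee_fin w0.
- apply/trivIsetP => i j _ _ ij; move/trivIsetP: tF => /(_ i j I I ij).
  rewrite -subset0 => ijF; rewrite -subset0 => x [[_ Fi] [_ Fj]].
  exact: (ijF (h x)).
Qed.

(** * Changes of variable for Lebesgue measure on the line *)

Section lebesgue.
Variable R : realType.
Local Notation mu := (@lebesgue_measure R).
Local Notation pos := (`]0%R, +oo[%classic : set R).
Local Open Scope ereal_scope.

Lemma ge0_integral_opp (f : R -> \bar R) : measurable_fun setT f ->
  (forall x, 0 <= f x) -> \int[mu]_x f (- x)%R = \int[mu]_x f x.
Proof.
move=> mf f0.
transitivity (\int[pushforward mu (-%R : R -> measurableTypeR R)]_x f x).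
  by rewrite ge0_integral_pushforward ?preimage_setT.
by apply: eq_measure_integral => A mA _; exact: lebesgue_measureN.
Qed.

Lemma lebesgue_measureD (c : R) (A : set R) : measurable A ->
  pushforward mu (+%R^~ c : R -> measurableTypeR R) A = mu A.
Proof.
have mc : measurable_fun [set: R] (+%R^~ c : R -> measurableTypeR R).
  exact: measurable_funD.
move=> mA; apply/esym/lebesgue_measure_unique => //= _ [[a b]] _ <-.
rewrite /pushforward/= (_ : _ @^-1` _ = `](a - c)%R, (b - c)%R]%classic); last first.
  by apply/seteqP; split => x /=; rewrite !in_itv/= ltrBlDr lerBrDr.
by rewrite !lebesgue_measure_itv/= !lte_fin ltrD2r -!EFinB opprB addrA subrK.
Qed.

Lemma ge0_integral_translate (c : R) (D : set R) (f : R -> \bar R) :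
  measurable D -> measurable_fun D f -> (forall x, 0 <= f x) ->
  \int[mu]_(x in +%R^~ c @^-1` D) f (x + c)%R = \int[mu]_(x in D) f x.
Proof.
move=> mD mf f0.
have mc : measurable_fun [set: R] (+%R^~ c : R -> measurableTypeR R).
  exact: measurable_funD.
transitivity (\int[pushforward mu (+%R^~ c : R -> measurableTypeR R)]_(x in D) f x).
  by rewrite ge0_integral_pushforward.
by apply: eq_measure_integral => A mA _; exact: lebesgue_measureD.
Qed.

Lemma ge0_integral_reflect (c : R) (f : R -> \bar R) : measurable_fun setT f ->
  (forall x, 0 <= f x) -> \int[mu]_x f (c - x)%R = \int[mu]_x f x.
Proof.
move=> mf f0.
rewrite -[RHS](@ge0_integral_translate c)// preimage_setT -[RHS]ge0_integral_opp//.
  by apply: eq_integral => x _; rewrite addrC.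
by apply: (measurableT_comp mf); exact: measurable_funD.
Qed.

Lemma measurable_inv_pos : measurable_fun pos (fun a : R => a^-1)%R.
Proof.
apply: open_continuous_measurable_fun; first exact: interval_open.
move=> a; rewrite inE/= in_itv/= andbT => a0.
by apply: inv_continuous; rewrite gt_eqF.
Qed.

Lemma integral_inv_itv (a b : R) : (0 < a)%R -> (a < b)%R ->
  \int[mu]_(x in `]a, b]) (x^-1)%:E = (ln b - ln a)%:E.
Proof.
move=> a0 ab.
have sub (i : interval R) : {subset i <= `[a, b]} ->
    [set` i] `<=` pos.
  move=> iab x /= /iab; rewrite !in_itv/= andbT => /andP[ax _].
  exact: lt_le_trans ax.
rewrite integral_itv_obnd_cbnd; last first.
  apply/measurable_EFinP; apply: measurable_funS measurable_inv_pos => //.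
  by apply: sub => x; rewrite !in_itv/= => /andP[/ltW-> ->].
rewrite (@continuous_FTC2 _ _ (@ln R)) ?EFinB//.
- apply: continuous_in_subspaceT => x; rewrite inE/= in_itv/= => /andP[ax _].
  by apply: inv_continuous; rewrite gt_eqF// (lt_le_trans a0).
- split.
  + move=> x; rewrite in_itv/= => /andP[ax _].
    by have [] := is_derive1_ln (lt_trans a0 ax).
  + by apply: cvg_at_right_filter; exact: continuous_ln.
  + by apply: cvg_at_left_filter; apply: continuous_ln; exact: lt_trans ab.
- move=> x; rewrite in_itv/= => /andP[ax _].
  by rewrite derive1E; apply: derive_val; apply: is_derive1_ln; exact: lt_trans ax.
Qed.

(** The image of da/a under [ln] gives each interval []a, b]] the mass [b - a], so it is Lebesgue
    measure. *)
Lemma ge0_integral_expR (f : R -> \bar R) : measurable_fun setT (f \o expR) ->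
  (forall x, 0 <= f x) ->
  \int[mu]_(a in `]0%R, +oo[) (f a * (a^-1)%:E) = \int[mu]_s f (expR s).
Proof.
move=> mf f0.
have mln : measurable_fun pos (@ln R : R -> measurableTypeR R).
  exact: measurable_funTS.
have inv0 (a : R) : pos a -> (0 <= a^-1)%R.
  by rewrite /= in_itv/= andbT invr_ge0 => /ltW.
rewrite (@ge0_integral_density _ _ (measurableTypeR R) (measurableTypeR R) R mu
  pos (@ln R) (fun a => a^-1)%R mu _ _ measurable_inv_pos inv0 _ (f \o expR))//.
- apply: eq_integral => a; rewrite inE/= in_itv/= andbT => a0.
  by rewrite lnK.
- move=> A mA.
  pose M (B : set (measurableTypeR R)) := \int[mu]_(x in pos `&` @ln R @^-1` B) (x^-1)%:E.
  have M0 : M set0 = 0 by rewrite /M preimage_set0 setI0 integral_set0.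
  have M_ge0 B : 0 <= M B by apply: integral_ge0 => x [? _]; rewrite lee_fin inv0.
  pose mM := isMeasure.Build _ (measurableTypeR R) R M M0 M_ge0
    (@density_sigma_additive _ _ (measurableTypeR R) (measurableTypeR R) R mu pos
      _ _ (measurable_itv _) mln measurable_inv_pos inv0).
  pose M' : {measure set (measurableTypeR R) -> \bar R} := HB.pack M mM.
  apply: (lebesgue_measure_unique (mu := M')) => // _ [[a b]] _ <-.
  (* The half-open interval pulls back along [ln] to the half-open interval between the
     exponentials. *)
  rewrite /= /M (_ : _ `&` _ = `]expR a, expR b]%classic); last first.
    apply/seteqP; split => x /=; rewrite !in_itv/= ?andbT.
      by move=> [x0 /andP[ax xb]]; rewrite -(lnK x0) ltr_expR ler_expR ax.
    move=> /andP[ax xb]; have x0 := lt_trans (expR_gt0 a) ax; split => //.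
    by rewrite -ltr_expR -ler_expR lnK// ax.
  rewrite lebesgue_measure_itv/= lte_fin; case: ltP => ab.
    by rewrite integral_inv_itv ?expR_gt0 ?ltr_expR// !expRK EFinB.
  by rewrite set_itv_ge ?integral_set0// bnd_simp -leNgt ler_expR.
- by move=> x; exact: f0.
Qed.

(** The shifted period is cut at [pi]; the part beyond [pi] is moved back by [2 * pi], where it
    fills the gap left at the lower end. *)
Lemma ge0_integral_periodic (h : R -> \bar R) (c : R) :
  measurable_fun setT h -> (forall x, 0 <= h x) ->
  (forall t, h (t + 2 * pi)%R = h t) -> (0 <= c <= 2 * pi)%R ->
  \int[mu]_(t in `](- pi)%R, pi]) h (t + c)%R = \int[mu]_(t in `](- pi)%R, pi]) h t.
Proof.
move=> mh h0 hper /andP[c0 c2].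
have pi0 := pi_gt0 R.
have shift (d a b : R) : (+%R^~ d) @^-1` `](a + d)%R, (b + d)%R]%classic = `]a, b]%classic.
  by apply/seteqP; split => x /=; rewrite !in_itv/= ltrD2r lerD2r.
have splitting (a b d : R) : (a <= b)%R -> (b <= d)%R ->
    \int[mu]_(t in `]a, d]) h t =
    \int[mu]_(t in `]a, b]) h t + \int[mu]_(t in `]b, d]) h t.
  move=> ab bd; rewrite -ge0_integral_setU//.
  - by rewrite -itv_bndbnd_setU// bnd_simp.
  - exact: measurable_funTS.
  - apply/disj_setPLR => x /=; rewrite !in_itv/= => /andP[_ xb].
    by apply/negP; rewrite negb_and -leNgt xb.
rewrite -{1}(shift c) (@ge0_integral_translate c)//; last exact: measurable_funTS.
rewrite (@splitting _ pi) ?lerDl//; last by rewrite -lerBrDl; lra.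
rewrite [RHS](@splitting _ (- pi + c)%R) ?lerDl//; last lra.
rewrite addeC; congr (_ + _).
have -> : `]pi, (pi + c)%R] = `](- pi + 2 * pi)%R, (- pi + c + 2 * pi)%R] :> interval R.
  by congr `] _, _]; ring.
rewrite -(@ge0_integral_translate (2 * pi)) ?shift//; last exact: measurable_funTS.
by apply: eq_integral => t _; rewrite hper.
Qed.

End lebesgue.

(** * Tonelli's theorem on rectangles and triple products *)

Section tonelli_rectangle.
Local Open Scope ereal_scope.
Context d1 d2 (T1 : measurableType d1) (T2 : measurableType d2) (R : realType).
Variables (m1 : {sigma_finite_measure set T1 -> \bar R})
  (m2 : {sigma_finite_measure set T2 -> \bar R}).
Variables (A : set T1) (B : set T2) (f : T1 * T2 -> \bar R).
Hypotheses (mA : measurable A) (mB : measurable B).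
Hypotheses (mf : measurable_fun (A `*` B) f).
Hypothesis f0 : forall z, (A `*` B) z -> 0 <= f z.

(** Extension by zero off the rectangle, which reduces the lemmas below to Tonelli on the whole
    product. *)
Let fAB := f \_ (A `*` B).

Let fAB0 z : 0 <= fAB z.
Proof. by rewrite /fAB patchE; case: ifPn => // /set_mem; exact: f0. Qed.

Let mfAB : measurable_fun setT fAB.
Proof. by apply/(measurable_restrictT _ _).1 => //; exact: measurableX. Qed.

Let sectionl x : \int[m2]_y fAB (x, y) = ((fun x => \int[m2]_(y in B) f (x, y)) \_ A) x.
Proof.
rewrite patchE; case: ifPn => xA.
  rewrite [RHS]integral_mkcond; apply: eq_integral => y _.
  by rewrite /fAB !patchE in_setX xA.
rewrite (eq_integral (cst 0)) ?integral0// => y _.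
by rewrite /fAB patchE in_setX (negbTE xA).
Qed.

Let sectionr y : \int[m1]_x fAB (x, y) = ((fun y => \int[m1]_(x in A) f (x, y)) \_ B) y.
Proof.
rewrite patchE; case: ifPn => yB.
  rewrite [RHS]integral_mkcond; apply: eq_integral => x _.
  by rewrite /fAB !patchE in_setX yB andbT.
rewrite (eq_integral (cst 0)) ?integral0// => x _.
by rewrite /fAB patchE in_setX (negbTE yB) andbF.
Qed.

Lemma ge0_integral_setX :
  \int[m1 \x m2]_(z in A `*` B) f z = \int[m1]_(x in A) \int[m2]_(y in B) f (x, y).
Proof.
rewrite integral_mkcond fubini_tonelli1// [RHS]integral_mkcond.
by apply: eq_integral => x _; exact: sectionl.
Qed.

Lemma ge0_integral_exchange :
  \int[m1]_(x in A) \int[m2]_(y in B) f (x, y) =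
  \int[m2]_(y in B) \int[m1]_(x in A) f (x, y).
Proof.
rewrite integral_mkcond [RHS]integral_mkcond.
under eq_integral do rewrite -sectionl.
under [RHS]eq_integral do rewrite -sectionr.
exact: fubini_tonelli.
Qed.

Lemma measurable_integral_section :
  measurable_fun A (fun x => \int[m2]_(y in B) f (x, y)).
Proof.
apply/(measurable_restrictT _ mA).2.
rewrite (_ : _ \_ _ = fubini_F m2 fAB); first exact: measurable_fun_fubini_tonelli_F.
by apply/funext => x; rewrite -sectionl.
Qed.

Lemma measurable_integral_sectionr :
  measurable_fun B (fun y => \int[m1]_(x in A) f (x, y)).
Proof.
apply/(measurable_restrictT _ mB).2.
rewrite (_ : _ \_ _ = fubini_G m1 fAB); first exact: measurable_fun_fubini_tonelli_G.
by apply/funext => y; rewrite -sectionr.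
Qed.

End tonelli_rectangle.

(** Needed to treat the product of the first two measures as one factor of a triple product. The
    exhaustions are taken increasing so that a single index serves both coordinates. *)
Lemma sigma_finite_prod d1 d2 (T1 : measurableType d1) (T2 : measurableType d2)
    (R : realType) (m1 : {sigma_finite_measure set T1 -> \bar R})
    (m2 : {sigma_finite_measure set T2 -> \bar R}) :
  sigma_finite setT (m1 \x m2)%E.
Proof.
have /sigma_finiteP[F [FT Fnd Fmu]] := sigma_finiteT m1.
have /sigma_finiteP[G [GT Gnd Gmu]] := sigma_finiteT m2.
exists (fun n => F n `*` G n) => [|n].
  apply/esym; rewrite -subTset => -[x y] _.
  have [i _ Fx] : (\bigcup_i F i) x by rewrite -FT.
  have [j _ Gy] : (\bigcup_j G j) y by rewrite -GT.
  exists (maxn i j) => //; split => /=.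
    by move: Fx; apply/subsetPset/Fnd/leq_maxl.
  by move: Gy; apply/subsetPset/Gnd/leq_maxr.
have [mF Foo] := Fmu n; have [mG Goo] := Gmu n.
split; first exact: measurableX.
by rewrite product_measure1E// lte_mul_pinfty// ge0_fin_numE.
Qed.

Lemma ge0_integral_setX3 d1 d2 d3 (T1 : measurableType d1) (T2 : measurableType d2)
    (T3 : measurableType d3) (R : realType)
    (m1 : {sigma_finite_measure set T1 -> \bar R})
    (m2 : {sigma_finite_measure set T2 -> \bar R})
    (m3 : {sigma_finite_measure set T3 -> \bar R})
    (A : set T1) (B : set T2) (C : set T3) (f : T1 * T2 * T3 -> \bar R) :
  measurable A -> measurable B -> measurable C ->
  measurable_fun ((A `*` B) `*` C) f ->
  (forall z, ((A `*` B) `*` C) z -> 0 <= f z)%E ->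
  (\int[(m1 \x m2) \x m3]_(z in (A `*` B) `*` C) f z =
   \int[m1]_(x in A) \int[m2]_(y in B) \int[m3]_(z in C) f (x, y, z))%E.
Proof.
move=> mA mB mC mf f0; have mAB := measurableX mA mB.
pose m12 : {sigma_finite_measure set (T1 * T2)%type -> \bar R} :=
  HB.pack (m1 \x m2)%E (Measure_isSigmaFinite.Build _ _ _ (m1 \x m2)%E
    (sigma_finite_prod m1 m2)).
rewrite (@ge0_integral_setX _ _ _ _ _ m12)//.
rewrite ge0_integral_setX//.
- exact: measurable_integral_section.
- by move=> z zAB; apply: integral_ge0 => a Ca; exact: f0.
Qed.

Lemma lebesgue_exchange (R : realType) (A B : set R) (f : R -> R -> \bar R) :
  measurable A -> measurable B ->
  measurable_fun setT (fun z : measurableTypeR R * measurableTypeR R => f z.1 z.2) ->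
  (forall x y, 0 <= f x y)%E ->
  (\int[lebesgue_measure]_(x in A) \int[lebesgue_measure]_(y in B) f x y =
   \int[lebesgue_measure]_(y in B) \int[lebesgue_measure]_(x in A) f x y)%E.
Proof.
move=> mA mB mf f0.
exact: (@ge0_integral_exchange _ _ (measurableTypeR R) (measurableTypeR R) R
  lebesgue_measure lebesgue_measure A B (fun z => f z.1 z.2) mA mB
  (measurable_funTS mf) (fun z _ => f0 z.1 z.2)).
Qed.

(** * Haar measure in Iwasawa coordinates *)

Section SL2_measurable.
Variable R : realType.
Implicit Types g h : SL2 R.

Lemma sl2_mxM g h : sl2_mx (g * h)%g = sl2_mx g *m sl2_mx h.
Proof. by []. Qed.

Lemma sl2_mx_inj : injective (@sl2_mx R).
Proof. exact: val_inj. Qed.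

Lemma sl2_mxE (y : SL2 R) : sl2_mx y = mx22 (sl2_mx y 0 0) (sl2_mx y 0 1)
  (sl2_mx y 1 0) (sl2_mx y 1 1).
Proof.
by apply/matrixP => i j; rewrite mxE;
  case: i j => -[|[|i]]// i2 [[|[|j]]//= j2]; congr (sl2_mx y _ _); exact: val_inj.
Qed.

Lemma sl2_det22 (y : SL2 R) :
  sl2_mx y 0 0 * sl2_mx y 1 1 - sl2_mx y 0 1 * sl2_mx y 1 0 = 1.
Proof. by rewrite -det_mx22 -sl2_mxE sl2_det. Qed.

Lemma measurable_entry (i j : 'I_2) :
  measurable_fun setT (fun g => sl2_mx g i j : R).
Proof.
apply: (measurability (@RGenOpens.G R)).
  exact: RGenOpens.measurableE.
move=> _ [_ [a [b ->]] <-]; rewrite setTI.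
apply: sub_sigma_algebra.
exists ((fun M : 'M[R]_2 => M i j) @^-1` `]a, b[%classic) => //.
have /continuousP := @coord_continuous R 2 2 i j; apply.
exact: interval_open.
Qed.

Lemma measurable_SL2 d (T : measurableType d) (D : set T) (h : T -> SL2 R) :
  measurable D -> (forall i j, measurable_fun D (fun x => sl2_mx (h x) i j)) ->
  measurable_fun D h.
Proof.
move=> mD mh.
apply: (@measurability _ _ _ _ _ _ (@open (SL2 R))) => //.
move=> _ [U oU <-]; have [V oV <-] := oU.
rewrite -[X in _ `&` X]/((fun x => sl2_mx (h x)) @^-1` V).
exact: measurable_mx.
Qed.

Lemma measurable_mulr (y : SL2 R) : measurable_fun setT (fun g => (g * y)%g).
Proof.
apply: measurable_SL2 => // i j.
rewrite (_ : (fun g => _) =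
    fun g => sl2_mx g i 0 * sl2_mx y 0 j + sl2_mx g i 1 * sl2_mx y 1 j).
  by apply: measurable_funD; apply: measurable_funM => //; exact: measurable_entry.
apply/funext => g; rewrite sl2_mxM mxE.
by rewrite !big_ord_recl big_ord0 addr0; congr (_ + sl2_mx g _ _ * sl2_mx y _ _); apply/val_inj.
Qed.

Lemma measurable_normsq (f : SL2 R -> R[i]) :
  measurable_fun setT (fun g => complex.Re (f g)) ->
  measurable_fun setT (fun g => complex.Im (f g)) ->
  measurable_fun setT (fun g => (normsq (f g))%:E).
Proof.
move=> mRe mIm; apply/measurable_EFinP.
rewrite (_ : (fun _ => _) =
    fun g => complex.Re (f g) ^+ 2 + complex.Im (f g) ^+ 2); last first.
  apply/funext => g; rewrite /normsq; case: (f g) => a b /=.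
  by rewrite sqr_sqrtr// addr_ge0 ?sqr_ge0.
by apply: measurable_funD; exact: measurable_funX.
Qed.

End SL2_measurable.

Section haar_coordinates.
Variable R : realType.
Local Notation mu := (@lebesgue_measure R).
Local Notation pos := (`]0%R, +oo[%classic : set R).
Local Open Scope ereal_scope.

Lemma ge0_integral_haar (phi : SL2 R -> \bar R) :
  measurable_fun setT phi -> (forall g, 0 <= phi g) ->
  \int[haar (R := R)]_g phi g = \int[(mu \x mu) \x mu]_(x in @iwasawa_dom R)
    (phi (iwasawa x) * (x.2^-1)%:E).
Proof.
move=> mphi phi0.
have inv0 (x : R * R * R) : iwasawa_dom x -> (0 <= x.2^-1)%R.
  by move=> [_ x0]; rewrite invr_ge0 ltW.
have H := @ge0_integral_density _ _
  (measurableTypeR R * measurableTypeR R * measurableTypeR R)%type (SL2 R) R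
  ((mu \x mu) \x mu) (@iwasawa_dom R)
  (@iwasawa R) (fun x => x.2^-1)%R (@haar R) (@measurable_iwasawa_dom R)
  (@measurable_iwasawa R) (@measurable_inv_iwasawa R) inv0.
exact: (H (fun _ _ => erefl) phi mphi phi0).
Qed.

Lemma ge0_integral_iwasawa_box (phi : SL2 R -> \bar R) (A B : set R) :
  measurable A -> measurable B -> A `<=` `](- pi)%R, pi]%classic ->
  measurable_fun setT phi -> (forall g, 0 <= phi g) ->
  \int[(mu \x mu) \x mu]_(x in (A `*` B) `*` pos)
    (phi (iwasawa x) * (x.2^-1)%:E) =
  \int[mu]_(t in A) \int[mu]_(T in B) \int[mu]_(a in pos)
    (phi (kna t T a) * (a^-1)%:E).
Proof.
move=> mA mB Api mphi phi0.
have sub : (A `*` B) `*` pos `<=` @iwasawa_dom R.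
  move=> x [[/= xA _]]; rewrite in_itv/= andbT => x0; split => //.
  by have /= := Api _ xA; rewrite in_itv.
have mf : measurable_fun ((A `*` B) `*` pos :
    set (measurableTypeR R * measurableTypeR R * measurableTypeR R))
    (fun x => phi (iwasawa x) * (x.2^-1)%:E).
  apply: (@measurable_funS _ _ _ _ (@iwasawa_dom R) _ _ (@measurable_iwasawa_dom R) sub).
  apply: emeasurable_funM.
    apply: (measurableT_comp mphi (@measurable_iwasawa R)).
  apply/measurable_EFinP.
  exact: (@measurable_inv_iwasawa R).
have f0 x : ((A `*` B) `*` pos) x -> 0 <= phi (iwasawa x) * (x.2^-1)%:E.
  by move=> /sub [_ x0]; rewrite mule_ge0// lee_fin invr_ge0 ltW.
have H := @ge0_integral_setX3 _ _ _ (measurableTypeR R) (measurableTypeR R)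
  (measurableTypeR R) R mu mu mu A B pos _ mA mB (measurable_itv _) mf f0.
exact: H.
Qed.

(** By monotonicity it is enough that the preimage of [S] in the chart lies in [B]; this is how the
    tube will be compared with the box. *)
Lemma ge0_integral_haar_le (phi : SL2 R -> \bar R) (S : set (SL2 R))
    (B : set (measurableTypeR R * measurableTypeR R * measurableTypeR R)) :
  measurable S -> measurable B -> B `<=` @iwasawa_dom R ->
  (forall x, iwasawa_dom x -> S (iwasawa x) -> B x) ->
  measurable_fun setT phi -> (forall g, 0 <= phi g) ->
  \int[haar (R := R)]_(g in S) phi g <=
  \int[(mu \x mu) \x mu]_(x in B) (phi (iwasawa x) * (x.2^-1)%:E).
Proof.
move=> mS mB Bdom SB mphi phi0.
have mphiS : measurable_fun setT (phi \_ S).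
  by apply/(measurable_restrictT _ _).1 => //; exact: measurable_funTS.
have phiS0 g : 0 <= (phi \_ S) g by rewrite patchE; case: ifP.
have H := ge0_integral_haar mphiS phiS0.
rewrite integral_mkcond; rewrite H.
have -> : \int[(mu \x mu) \x mu]_(x in @iwasawa_dom R)
      ((phi \_ S) (iwasawa x) * (x.2^-1)%:E) =
    \int[(mu \x mu) \x mu]_(x in @iwasawa_dom R `&` @iwasawa R @^-1` S)
      (phi (iwasawa x) * (x.2^-1)%:E).
  rewrite [RHS]integral_mkcondr; apply: eq_integral => x _; rewrite !patchE.
  by rewrite -[x \in _]/(iwasawa x \in S); case: ifP; rewrite ?mul0e.
have mf : measurable_fun B (fun x => phi (iwasawa x) * (x.2^-1)%:E).
  apply: (@measurable_funS _ _ _ _ (@iwasawa_dom R) _ _ (@measurable_iwasawa_dom R) Bdom).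
  apply: emeasurable_funM.
    by apply: (measurableT_comp mphi (@measurable_iwasawa R)).
  by apply/measurable_EFinP; exact: (@measurable_inv_iwasawa R).
have mSB : measurable (@iwasawa_dom R `&` @iwasawa R @^-1` S).
  exact: (@measurable_iwasawa R (@measurable_iwasawa_dom R) _ mS).
apply: (@ge0_subset_integral _ _ _ ((mu \x mu) \x mu) _ _ mSB mB _ mf).
  by move=> x /Bdom [_ x0]; rewrite mule_ge0// lee_fin invr_ge0 ltW.
by move=> x [dx Sx]; exact: SB.
Qed.

(** The dilation parameter is written [expR (c x)] to be positive everywhere, so that [knaE] applies
    on the whole space. *)
Lemma measurable_kna d (X : measurableType d) (a b c : X -> R) :
  measurable_fun setT a -> measurable_fun setT b -> measurable_fun setT c ->
  measurable_fun setT (fun x => kna (a x) (b x) (expR (c x))).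
Proof.
move=> ma mb mc; apply: measurable_SL2 => // i j.
have mcos : measurable_fun setT (fun x => cos (a x)).
  apply: (measurableT_comp (f := cos)) => //.
  by apply: continuous_measurable_fun; exact: continuous_cos.
have msin : measurable_fun setT (fun x => sin (a x)).
  apply: (measurableT_comp (f := sin)) => //.
  by apply: continuous_measurable_fun; exact: continuous_sin.
have mexp : measurable_fun setT (fun x => expR (c x)).
  by apply: (measurableT_comp (f := expR)) => //; exact: measurable_expR.
have mexpN : measurable_fun setT (fun x => expR (- c x)%R).
  apply: (measurableT_comp (f := expR)); first exact: measurable_expR.
  exact: measurable_funN.
under eq_fun do rewrite knaE ?expR_gt0//.
by case: i j => -[|[|i]]// i2 [[|[|j]]//= j2];
  under eq_fun do rewrite mxE/= -?expRN; repeat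
  first [exact: mexpN | exact: mexp | exact: mcos | exact: msin | exact: mb
       | apply: measurable_funM | apply: measurable_funB
       | apply: measurable_funD].
Qed.

(** Putting [a = expR s] absorbs the density [1 / a]: Haar measure becomes plain Lebesgue measure in
    [(t, T, s)], where invariance amounts to measure-preserving substitutions. *)
Lemma ge0_integral_haar_kna (phi : SL2 R -> \bar R) :
  measurable_fun setT phi -> (forall g, 0 <= phi g) ->
  \int[haar (R := R)]_g phi g = \int[mu]_(t in `](- pi)%R, pi]) \int[mu]_T
    \int[mu]_s phi (kna t T (expR s)).
Proof.
move=> mphi phi0.
have domE : @iwasawa_dom R = (`](- pi)%R, pi]%classic `*` setT) `*` pos.
  apply/seteqP; split => -[[t T] a] /=; rewrite !in_itv/= ?andbT.
    by move=> [].
  by move=> [[]].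
have H := @ge0_integral_iwasawa_box phi `](- pi)%R, pi]%classic setT
  (measurable_itv _) measurableT (@subset_refl _ _) mphi phi0.
have H0 := ge0_integral_haar mphi phi0.
rewrite domE in H0.
apply: (etrans H0); apply: (etrans H).
apply: eq_integral => t _; apply: eq_integral => T _.
rewrite (@ge0_integral_expR _ (fun a => phi (kna t T a)))//.
by apply: (measurableT_comp mphi); exact: measurable_kna.
Qed.

(** Moving a unipotent to the left of a dilation scales its parameter by [a^2]. *)
Lemma kna_unip (t T s x : R) :
  (kna t T (expR s) * unip x)%g = kna t (T + expR s ^+ 2 * x)%R (expR s).
Proof.
apply: sl2_mx_inj; rewrite sl2_mxM !knaE ?expR_gt0//.
have e0 : expR s != 0%R by rewrite gt_eqF ?expR_gt0.
apply/matrixP => i j; rewrite !mxE !big_ord_recl !big_ord0 !mxE /=.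
by case: i j => -[|[|i]]// i2 [[|[|j]]//= j2]; field.
Qed.

Lemma kna_dilat (t T s c : R) :
  (kna t T (expR s) * dilat (expR c))%g = kna t T (expR (s + c)).
Proof.
apply: sl2_mx_inj; rewrite sl2_mxM !knaE ?expR_gt0// dilatE ?gt_eqF ?expR_gt0// expRD.
have e0 : expR s != 0%R by rewrite gt_eqF ?expR_gt0.
have c0 : expR c != 0%R by rewrite gt_eqF ?expR_gt0.
apply/matrixP => i j; rewrite !mxE !big_ord_recl !big_ord0 !mxE /=.
by case: i j => -[|[|i]]// i2 [[|[|j]]//= j2]; field; rewrite ?e0 ?c0.
Qed.

Lemma sin_atan (x : R) : sin (atan x) = (x / Num.sqrt (1 + x ^+ 2))%R.
Proof.
have c0 : cos (atan x) != 0%R.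
  by rewrite cos_atan invr_eq0 sqrtr_eq0 -ltNge ltr_pwDl// sqr_ge0.
by rewrite -cos_atan -{2}(atanK x) /tan divfK.
Qed.

Fact weyl_subproof : \det (mx22 0 (-1) 1 0 : 'M[R]_2) == 1%R.
Proof. by rewrite det_mx22 mul0r mulN1r sub0r opprK. Qed.

Definition weyl : SL2 R := MkSL2 weyl_subproof.

(** Right multiplication by [weyl] turns the columns [(u, v)] into [(v, - u)]. The angle from [u] to
    [v] has cotangent [T], the new inner product is [- T], and the new first column has length
    [|v| = sqrt (1 + T^2) / |u|]. *)
Lemma kna_weyl (t T s : R) : (kna t T (expR s) * weyl)%g =
  kna (t + (pi / 2 - atan T)) (- T) (expR (ln (Num.sqrt (1 + T ^+ 2)) - s)).
Proof.
have r2 : (0 < 1 + T ^+ 2)%R by rewrite ltr_pwDl// sqr_ge0.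
apply: sl2_mx_inj; rewrite sl2_mxM !knaE ?expR_gt0// expRD expRN lnK ?posrE ?sqrtr_gt0//.
have cE : cos (pi / 2 - atan T) = (T / Num.sqrt (1 + T ^+ 2))%R.
  by rewrite addrC cosDpihalf sinN opprK sin_atan.
have sE : sin (pi / 2 - atan T) = (Num.sqrt (1 + T ^+ 2))^-1%R.
  by rewrite addrC sinDpihalf cosN cos_atan.
rewrite cosD sinD cE sE.
have e0 : expR s != 0%R by rewrite gt_eqF ?expR_gt0.
have rr : ((Num.sqrt (1 + T ^+ 2)) ^+ 2 = 1 + T ^+ 2)%R by rewrite sqr_sqrtr// ltW.
have : Num.sqrt (1 + T ^+ 2) != 0%R by rewrite gt_eqF ?sqrtr_gt0.
move: rr; set r := Num.sqrt _ => rr r0.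
apply/matrixP => i j; rewrite !mxE !big_ord_recl !big_ord0 !mxE /=.
case: i j => -[|[|i]]// i2 [[|[|j]]//= j2].
- by field; rewrite r0 e0.
(* The entries agree only through [r ^+ 2 = 1 + T ^+ 2], inserted as a quotient equal to 1. *)
- transitivity (- (expR s * cos t) * ((1 + T ^+ 2) / r ^+ 2))%R.
    by rewrite -rr divff ?expf_neq0//; ring.
  by field; rewrite r0 e0.
- by field; rewrite r0 e0.
- transitivity (- (expR s * sin t) * ((1 + T ^+ 2) / r ^+ 2))%R.
    by rewrite -rr divff ?expf_neq0//; ring.
  by field; rewrite r0 e0.
Qed.

End haar_coordinates.

(** * Right invariance of Haar measure *)

Section right_invariance.
Variable R : realType.
Local Notation mu := (@lebesgue_measure R).
Local Open Scope ereal_scope.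

(** Stated for one element at a time: the property is stable under products, so generators
    suffice. *)
Definition right_invariant (y : SL2 R) := forall phi : SL2 R -> \bar R,
  measurable_fun setT phi -> (forall g, 0 <= phi g) ->
  \int[haar (R := R)]_g phi (g * y)%g = \int[haar (R := R)]_g phi g.

Lemma right_invariantM (y z : SL2 R) :
  right_invariant y -> right_invariant z -> right_invariant (y * z)%g.
Proof.
move=> iy iz phi mphi phi0; rewrite -(iz phi)// -(iy (fun g => phi (g * z)%g))//.
  by under eq_integral do rewrite mulgA.
by apply: (measurableT_comp mphi); exact: measurable_mulr.
Qed.

Lemma right_invariant_kna (y : SL2 R) :
  (forall phi : SL2 R -> \bar R, measurable_fun setT phi -> (forall g, 0 <= phi g) ->
    \int[mu]_(t in `](- pi)%R, pi]) \int[mu]_T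
      \int[mu]_s phi (kna t T (expR s) * y)%g =
    \int[mu]_(t in `](- pi)%R, pi]) \int[mu]_T
      \int[mu]_s phi (kna t T (expR s))) -> right_invariant y.
Proof.
move=> H phi mphi phi0; rewrite (ge0_integral_haar_kna mphi)// -H//.
rewrite (@ge0_integral_haar_kna R (fun g => phi (g * y)%g))//.
by apply: (measurableT_comp mphi); exact: measurable_mulr.
Qed.

Lemma right_invariant_dilat (a : R) : (0 < a)%R -> right_invariant (dilat a).
Proof.
move=> a0; rewrite -(lnK (a0 : a \is Num.pos)).
apply: right_invariant_kna => phi mphi phi0.
apply: eq_integral => t _; apply: eq_integral => T _.
under eq_integral do rewrite kna_dilat.
rewrite -[X in integral _ X]/((+%R^~ (ln a)) @^-1` setT).
rewrite (@ge0_integral_translate R _ setT (fun s => phi (kna t T (expR s))))//.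
by apply: (measurableT_comp mphi); exact: measurable_kna.
Qed.

(** The translation of [T] depends on [s], so the order of integration is exchanged to translate at
    fixed [s]. *)
Lemma right_invariant_unip (x : R) : right_invariant (unip x).
Proof.
apply: right_invariant_kna => phi mphi phi0.
apply: eq_integral => t _.
under eq_integral do under eq_integral do rewrite kna_unip.
have m1 : measurable_fun setT (fun z : measurableTypeR R * measurableTypeR R =>
   phi (kna t (z.1 + expR z.2 ^+ 2 * x)%R (expR z.2))).
  apply: (measurableT_comp mphi).
  have mb : measurable_fun setT (fun z : measurableTypeR R * measurableTypeR R =>
      (z.1 + expR z.2 ^+ 2 * x)%R : R).
    apply: measurable_funD; first exact: measurable_fst.
    apply: measurable_funM => //; apply: measurable_funX.
    apply: (measurableT_comp (@measurable_expR R)); exact: measurable_snd.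
  have mc : measurable_fun setT (fun z : measurableTypeR R * measurableTypeR R => z.2 : R).
    exact: measurable_snd.
  have H := measurable_kna (measurable_cst t) mb mc.
  exact: H.
have m2 : measurable_fun setT (fun z : measurableTypeR R * measurableTypeR R =>
   phi (kna t z.1 (expR z.2))).
  apply: (measurableT_comp mphi).
  exact: measurable_kna.
have E1 := @lebesgue_exchange R setT setT
  (fun T s => phi (kna t (T + expR s ^+ 2 * x)%R (expR s)))
  measurableT measurableT m1 (fun _ _ => phi0 _).
have E2 := @lebesgue_exchange R setT setT
  (fun T s => phi (kna t T (expR s))) measurableT measurableT m2 (fun _ _ => phi0 _).
apply: (etrans E1).
apply: (etrans _ (esym E2)).
apply: eq_integral => s _ /=.
have m3 : measurable_fun setT (fun T => phi (kna t T (expR s))).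
  apply: (measurableT_comp mphi).
  exact: (measurable_kna (measurable_cst t) (@measurable_id _ _ _) (measurable_cst s)).
exact: (ge0_integral_translate (expR s ^+ 2 * x) measurableT m3 (fun _ => phi0 _)).
Qed.

Lemma kna_periodic (t T a : R) : kna (t + 2 * pi) T a = kna t T a.
Proof.
rewrite /kna; congr (_ * _ * _)%g; apply: sl2_mx_inj => /=.
by rewrite mulr_natl cosD2pi sinD2pi.
Qed.

(** The three coordinates are treated in turn: [s] is reflected at fixed [t] and [T]; after an
    exchange, [t] is rotated by an angle depending on [T] only; finally [T] changes sign. *)
Lemma right_invariant_weyl : right_invariant (weyl R).
Proof.
apply: right_invariant_kna => phi mphi phi0.
pose H (t T : R) := \int[mu]_s phi (kna t T (expR s)).
pose angle (T : R) : R := (pi / 2 - atan T)%R.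
have mangle : measurable_fun setT angle.
  apply: measurable_funB => //; apply: continuous_measurable_fun.
  exact: continuous_atan.
have H0 t T : 0 <= H t T by exact: integral_ge0.
have mslice (t T : R) : measurable_fun setT (fun s => phi (kna t T (expR s))).
  apply: (measurableT_comp mphi).
  exact: (measurable_kna (measurable_cst t) (measurable_cst T) (@measurable_id _ _ _)).
have mH : measurable_fun setT (fun z : measurableTypeR R * measurableTypeR R => H z.1 z.2).
  have m1 : measurable_fun setT
      (fun z : measurableTypeR R * measurableTypeR R * measurableTypeR R => z.1.1 : R).
    by apply: (measurableT_comp measurable_fst); exact: measurable_fst.
  have m2 : measurable_fun setT
      (fun z : measurableTypeR R * measurableTypeR R * measurableTypeR R => z.1.2 : R).
    by apply: (measurableT_comp measurable_snd); exact: measurable_fst.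
  have m3 : measurable_fun setT
      (fun z : measurableTypeR R * measurableTypeR R * measurableTypeR R => z.2 : R).
    exact: measurable_snd.
  have m := measurableT_comp mphi (measurable_kna m1 m2 m3).
  exact: (@measurable_fun_fubini_tonelli_F _ _
    (measurableTypeR R * measurableTypeR R)%type (measurableTypeR R) R mu _ m (fun _ => phi0 _)).
have mH2 : measurable_fun setT (fun z : measurableTypeR R * measurableTypeR R =>
    H (z.1 + angle z.2)%R (- z.2)%R).
  have mg : measurable_fun setT (fun z : measurableTypeR R * measurableTypeR R =>
      ((z.1 + angle z.2)%R : measurableTypeR R, (- z.2)%R : measurableTypeR R)).
    apply: measurable_fun_pair.
      apply: measurable_funD; first exact: measurable_fst.
      by apply: (measurableT_comp mangle); exact: measurable_snd.
    by apply: (measurable_funN); exact: measurable_snd.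
  exact: (measurableT_comp mH mg).
have mHr T : measurable_fun setT (H^~ T).
  exact: (measurableT_comp mH (pair2_measurable _)).
transitivity (\int[mu]_(t in `](- pi)%R, pi]) \int[mu]_T H (t + angle T)%R (- T)%R).
  apply: eq_integral => t _; apply: eq_integral => T _.
  under eq_integral do rewrite kna_weyl.
  exact: (ge0_integral_reflect (ln (Num.sqrt (1 + T ^+ 2))) (mslice _ _) (fun _ => phi0 _)).
have mP : measurable (`](- pi)%R, pi]%classic : set R) by exact: measurable_itv.
have E1 := @lebesgue_exchange R `](- pi)%R, pi]%classic setT
  (fun t T => H (t + angle T)%R (- T)%R) mP measurableT mH2 (fun _ _ => H0 _ _).
have E2 := @lebesgue_exchange R `](- pi)%R, pi]%classic setT H mP measurableT mH H0.
apply: (etrans E1); apply: (etrans _ (esym E2)).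
transitivity (\int[mu]_T \int[mu]_(t in `](- pi)%R, pi]) H t (- T)%R).
  apply: eq_integral => T _.
  apply: (ge0_integral_periodic (mHr (- T)%R) (fun t => H0 t _)).
    by move=> t; apply: eq_integral => s _; rewrite kna_periodic.
  (* The angle lies strictly between 0 and [pi], within the range allowed by
     [ge0_integral_periodic]. *)
  rewrite /angle; have := atan_gtNpi2 T; have := atan_ltpi2 T; have := pi_gt0 R; lra.
have mI : measurable_fun setT (fun T => \int[mu]_(t in `](- pi)%R, pi]) H t T).
  exact: (@measurable_integral_sectionr _ _ (measurableTypeR R) (measurableTypeR R) R
    mu _ setT (fun z => H z.1 z.2) mP measurableT (measurable_funTS mH)
    (fun z _ => H0 z.1 z.2)).
exact: (ge0_integral_opp mI (fun _ => integral_ge0 _ (fun _ _ => H0 _ _))).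
Qed.

Lemma right_invariant_upper (a x : R) : (a != 0)%R ->
  exists2 y, right_invariant y & sl2_mx y = mx22 a x 0 a^-1.
Proof.
move=> a0.
have iV : right_invariant (weyl R * weyl R)%g.
  by apply: right_invariantM; exact: right_invariant_weyl.
have [a_gt0|a_le0] := ltP 0%R a.
  exists (dilat a * unip (x / a))%g.
    by apply: right_invariantM; [exact: right_invariant_dilat|exact: right_invariant_unip].
  rewrite sl2_mxM dilatE//.
  apply/matrixP => i j; rewrite !mxE !big_ord_recl !big_ord0 !mxE /=.
  by case: i j => -[|[|i]]// i2 [[|[|j]]//= j2]; field.
have a_lt0 : (0 < - a)%R by rewrite oppr_gt0 lt_neqAle a0.
(* The square of [weyl] is minus the identity, which reduces a negative diagonal to a positive
   one. *)
exists (weyl R * weyl R * (dilat (- a) * unip (x / a)))%g.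
  apply: right_invariantM => //.
  by apply: right_invariantM; [exact: right_invariant_dilat|exact: right_invariant_unip].
rewrite !sl2_mxM dilatE ?oppr_eq0//.
apply/matrixP => i j; do 3 rewrite !mxE ?big_ord_recl ?big_ord0 /=.
by case: i j => -[|[|i]]// i2 [[|[|j]]//= j2]; field.
Qed.

(* Bruhat decomposition: y = [p q; r s] with r <> 0 is n_{p/r} w [r s; 0 1/r]. *)
Lemma haar_right_invariant (y : SL2 R) : right_invariant y.
Proof.
have d1 := sl2_det22 y; have yE := sl2_mxE y.
move: d1 yE; set p := (sl2_mx y 0 0)%R; set q := (sl2_mx y 0 1)%R.
set r := (sl2_mx y 1 0)%R; set s := (sl2_mx y 1 1)%R => d1 yE.
have [r0|r0] := eqVneq r 0%R.
  rewrite r0 mulr0 subr0 in d1.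
  have p0 : (p != 0)%R by apply: contra_eq_neq d1 => ->; rewrite mul0r eq_sym oner_eq0.
  have [z iz zE] := right_invariant_upper q p0.
  suff -> : y = z by [].
  apply: sl2_mx_inj; rewrite yE zE r0; congr mx22.
  by apply: (mulfI p0); rewrite d1 divff.
have [z iz zE] := right_invariant_upper s r0.
suff -> : y = (unip (p / r) * (weyl R * z))%g.
  by apply: right_invariantM; [exact: right_invariant_unip|];
    apply: right_invariantM => //; exact: right_invariant_weyl.
apply: sl2_mx_inj; rewrite yE !sl2_mxM zE.
have -> : q = ((p * s - 1) / r)%R by rewrite -d1 opprB addrC subrK mulfK.
apply/matrixP => i j; do 3 rewrite !mxE ?big_ord_recl ?big_ord0 /=.
by case: i j => -[|[|i]]// i2 [[|[|j]]//= j2]; field.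
Qed.

End right_invariance.

(** * Covering by the Iwasawa box *)

Section covering.
Variable R : realType.
Implicit Types g y z : SL2 R.

(** By the mean value theorem [sin x = x * cos y] for some [y] between 0 and [x]. In the form
    [cot x <= 1 / x] this relates the bound on [T] to the angle of the sector. *)
Lemma mul_cos_le_sin (x : R) : 0 < x -> x < pi / 2 -> x * cos x <= sin x.
Proof.
move=> x0 xpi.
have dsin (y : R) : y \in `]0, x[ -> is_derive y 1 sin (cos y).
  by move=> _; exact: is_derive_sin.
have csin : {within `[0, x], continuous (@sin R)}.
  by apply: continuous_subspaceT; exact: continuous_sin.
have [y yx] := MVT x0 dsin csin; move: yx; rewrite in_itv/= => /andP[y0 yx].
rewrite sin0 !subr0 => ->; rewrite mulrC ler_pM2r// ltW//.
have pi0 := pi_gt0 R.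
by rewrite ltr_cos// in_itv/=; apply/andP; split; lra.
Qed.

Lemma sin_lt_cos (x : R) : 0 < x -> x < pi / 4 -> sin x < cos x.
Proof.
move=> x0 xpi; have pi0 := pi_gt0 R.
have -> : sin x = cos (pi / 2 - x) by rewrite -cosN opprB cosBpihalf.
by rewrite ltr_cos ?in_itv/=; [lra|apply/andP; split; lra|apply/andP; split; lra].
Qed.

Lemma SL2Z_mul y z : SL2Z y -> SL2Z z -> SL2Z (y * z)%g.
Proof.
move=> hy hz i j; rewrite sl2_mxM mxE rpred_sum// => k _.
by rewrite rpredM.
Qed.

Lemma SL2Z_one : SL2Z (1%g : SL2 R).
Proof. by move=> i j; rewrite -[sl2_mx _]/1%:M mxE; case: (_ == _); rewrite ?rpred0 ?rpred1. Qed.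

(** For determinant 1 the inverse is the adjugate, which has integer entries. *)
Lemma SL2Z_inv y : SL2Z y -> SL2Z (y^-1)%g.
Proof.
move=> hy.
have d : \det (mx22 (sl2_mx y 1 1) (- sl2_mx y 0 1) (- sl2_mx y 1 0) (sl2_mx y 0 0)) == 1.
  by rewrite det_mx22 mulrNN mulrC sl2_det22.
have -> : (y^-1)%g = MkSL2 d.
  apply: (@mulgI _ y); rewrite mulgV; apply: sl2_mx_inj.
  rewrite sl2_mxM /= [X in X *m _]sl2_mxE.
  have := sl2_det22 y; set p := sl2_mx y 0 0; set q := sl2_mx y 0 1.
  set r := sl2_mx y 1 0; set s := sl2_mx y 1 1 => dd.
  apply/matrixP => i j; rewrite !mxE !big_ord_recl !big_ord0 !mxE /=.
  case: i j => -[|[|i]]// i2 [[|[|j]]//= j2]; rewrite ?mulr1n ?mulr0n;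
    first [ring | rewrite -dd; ring].
by move=> i j; rewrite mxE; do 2 case: ifP => _; rewrite ?rpredN.
Qed.

Definition lattice_basis g (ux uy vx vy : R) :=
  exists2 y, SL2Z y & sl2_mx (g * y)%g = mx22 ux vx uy vy.

Lemma lattice_basis_det g ux uy vx vy :
  lattice_basis g ux uy vx vy -> ux * vy - uy * vx = 1.
Proof. by move=> [y _ e]; rewrite -(sl2_det (g * y)%g) e det_mx22 [uy * _]mulrC. Qed.

(** Right multiplication by an integer matrix; the three changes of basis used by the Farey argument
    are instances. *)
Lemma lattice_basis_mul g ux uy vx vy (p q r s : int) : p * s - q * r = 1 ->
  lattice_basis g ux uy vx vy ->
  lattice_basis g (ux * p%:~R + vx * r%:~R) (uy * p%:~R + vy * r%:~R)
    (ux * q%:~R + vx * s%:~R) (uy * q%:~R + vy * s%:~R).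
Proof.
move=> d [y hy e].
have dz : \det (mx22 p%:~R q%:~R r%:~R s%:~R : 'M[R]_2) == 1.
  by rewrite det_mx22 -!intrM -intrB d.
exists (y * MkSL2 dz)%g.
  apply: SL2Z_mul => // i j; rewrite mxE.
  by do 2 case: ifP => _; rewrite intr_int.
rewrite mulgA sl2_mxM e /=.
apply/matrixP => i j; rewrite !mxE !big_ord_recl !big_ord0 !mxE /=.
by case: i j => -[|[|i]]// i2 [[|[|j]]//= j2]; rewrite addr0.
Qed.

Lemma lattice_basis_addr g ux uy vx vy : lattice_basis g ux uy vx vy ->
  lattice_basis g ux uy (ux + vx) (uy + vy).
Proof.
move=> /(@lattice_basis_mul g ux uy vx vy 1 1 0 1 erefl).
by rewrite !mulr1 !mulr0 !addr0.
Qed.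

Lemma lattice_basis_addl g ux uy vx vy : lattice_basis g ux uy vx vy ->
  lattice_basis g (ux + vx) (uy + vy) vx vy.
Proof.
move=> /(@lattice_basis_mul g ux uy vx vy 1 0 1 1 erefl).
by rewrite !mulr1 !mulr0 !add0r.
Qed.

Lemma lattice_basis_rot g ux uy vx vy : lattice_basis g ux uy vx vy ->
  lattice_basis g vx vy (- ux) (- uy).
Proof.
move=> /(@lattice_basis_mul g ux uy vx vy 0 (-1) 1 0 erefl).
by rewrite !mulr1 !mulr0 !mulrN1 !add0r !addr0.
Qed.

Definition sqnorm (M : 'M[R]_2) : R :=
  M 0 0 ^+ 2 + M 1 0 ^+ 2 + (M 0 1 ^+ 2 + M 1 1 ^+ 2).

Lemma le_sqnorm (M : 'M[R]_2) i j : `|M i j| <= 1 + sqnorm M.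
Proof.
have le1 (x : R) : `|x| <= 1 + x ^+ 2.
  by rewrite -(real_normK (num_real x)); have := sqr_ge0 (`|x| - 2^-1); nra.
apply: le_trans (le1 _) _; rewrite lerD2l /sqnorm.
have ord2 (k : 'I_2) : k = 0 \/ k = 1.
  by case: k => -[|[|k]]// k2; [left|right]; exact: val_inj.
have := sqr_ge0 (M 0 0); have := sqr_ge0 (M 1 0).
have := sqr_ge0 (M 0 1); have := sqr_ge0 (M 1 1).
by have [->|->] := ord2 i; have [->|->] := ord2 j; lra.
Qed.

(** If [g z] is no larger than [g], the entries of [z], computed as those of [g^-1 (g z)], are
    bounded. So the minimum is over a finite set of integer matrices, which contains the
    identity. *)
Lemma SL2Z_min_norm g : exists2 y, SL2Z y &
  forall z, SL2Z z -> sqnorm (sl2_mx (g * y)%g) <= sqnorm (sl2_mx (g * z)%g).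
Proof.
pose C := 1 + sqnorm (sl2_mx (g^-1)%g).
pose D := 1 + sqnorm (sl2_mx g).
(* An entry of [z] is a sum of two products, each at most [C * D] in absolute value. *)
pose B := Num.bound (2 * (C * D)).
have C0 : 0 <= C by rewrite /C /sqnorm !addr_ge0// ?sqr_ge0.
have D0 : 0 <= D by rewrite /D /sqnorm !addr_ge0// ?sqr_ge0.
have BP : 2 * (C * D) < B%:R by apply: archi_boundP; rewrite !mulr_ge0.
(* Integers from [- B] to [B] are coded by ordinals shifted by [B], which makes the candidates a
   finite type. *)
pose real (m : 'M['I_B.*2.+1]_2) : 'M[R]_2 := \matrix_(i, j) ((m i j)%:R - B%:R).
pose P m := `[< exists2 y, SL2Z y & sl2_mx y = real m >].
have small z : SL2Z z -> sqnorm (sl2_mx (g * z)%g) <= sqnorm (sl2_mx g) ->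
    exists m, sl2_mx z = real m.
  move=> hz zg.
  have bnd i j : `|sl2_mx z i j| <= B%:R.
    have -> : sl2_mx z i j = \sum_k sl2_mx (g^-1)%g i k * sl2_mx (g * z)%g k j.
      by rewrite -[z in LHS](mulKg g) [in LHS]sl2_mxM mxE.
    rewrite (le_trans (ler_norm_sum _ _ _))// (@le_trans _ _ (\sum_(k < 2) (C * D)))//.
      apply: ler_sum => k _; rewrite normrM ler_pM// ?le_sqnorm//.
      by apply: le_trans (le_sqnorm _ _ _) _; rewrite lerD2l.
    by rewrite sumr_const card_ord -[_ *+ 2]mulr_natl ltW.
  have H i j : exists k : 'I_B.*2.+1, sl2_mx z i j = k%:R - B%:R.
    have /intrP[m zm] := hz i j.
    have := bnd i j; rewrite zm ler_norml => /andP[m1 m2].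
    have m3 : (- B%:Z <= m <= B%:Z)%R.
      by apply/andP; split; rewrite -(ler_int R) ?mulrNz.
    have mB0 : (0 <= m + B%:Z)%R by lia.
    have mB : (absz (m + B%:Z)%R < B.*2.+1)%N by lia.
    exists (Ordinal mB) => /=.
    by rewrite natr_absz ger0_norm// intrD addrK.
  exists (\matrix_(i, j) projT1 (cid (H i j))).
  by apply/matrixP => i j; rewrite !mxE; case: cid.
have [m0 m0E] := small 1%g SL2Z_one (ltac:(by rewrite mulg1)).
have Pm0 : P m0 by apply/asboolP; exists 1%g => //; exact: SL2Z_one.
case: (@arg_minP _ _ _ m0 P (fun m => sqnorm (sl2_mx g *m real m)) Pm0).
move=> m /asboolP[y hy ym] min; exists y => // z hz.
have [zg|/ltW zg] := leP (sqnorm (sl2_mx (g * z)%g)) (sqnorm (sl2_mx g)).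
  have [mz mzE] := small z hz zg.
  rewrite !sl2_mxM ym mzE; apply: min; apply/asboolP; by exists z.
(* If [g z] is larger than [g], compare with the identity, coded by [m0]. *)
apply: le_trans zg; rewrite sl2_mxM ym -[sl2_mx g in leRHS]mulmx1.
by rewrite -[1%:M]/(sl2_mx (1%g : SL2 R)) m0E; exact: min.
Qed.

End covering.

(** * The Iwasawa box in terms of matrix entries *)

Section tube.
Variable R : realType.
Implicit Types g y z : SL2 R.

(** The region of angle at most [eps] and [T] at most [1 / eps] in absolute value, read off the
    columns of [g]: the argument of the first and their inner product. *)
Definition tube (eps : R) : set (SL2 R) := [set g |
  in_cone (cos eps) (sin eps) (sl2_mx g 0 0) (sl2_mx g 1 0) /\
  `|sl2_mx g 0 0 * sl2_mx g 0 1 + sl2_mx g 1 0 * sl2_mx g 1 1| <= 1 / eps].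

Lemma tube_cover (eps : R) g : 0 < eps -> eps < pi / 6 ->
  exists2 y, SL2Z y & tube eps (g * y)%g.
Proof.
move=> eps_gt0 eps_lt.
have pi2 : (pi / 2 : R) < 2 := pihalf_lt2 R; have pi0 : 0 < (pi : R) := pi_gt0 R.
(* From [pi < 4] and [eps < pi / 6]; it makes [1 / eps] at least 1, as a reduced basis requires. *)
have e1 : eps <= 1.
  lra.
have s0 : 0 < sin eps by apply: sin_gt0_pi; apply/andP; split; lra.
have sc : sin eps < cos eps by apply: sin_lt_cos => //; lra.
have M1 : 1 <= 1 / eps by rewrite ler_pdivlMr// mul1r.
have cM : cos eps <= 1 / eps * sin eps.
  by rewrite mul1r ler_pdivlMl// mul_cos_le_sin//; lra.
have [y0 hy0 min] := SL2Z_min_norm g.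
have Py0 := sl2_mxE (g * y0)%g.
have [|ux [uy [vx [vy [[y hy yE] cone T]]]]] :=
  @minimal_good_basis _ _ _ s0 sc (lattice_basis g)
    (@lattice_basis_det _ g) (@lattice_basis_addr _ g) (@lattice_basis_addl _ g)
    (@lattice_basis_rot _ g) (1 / eps) _ _ _ _ M1 cM (ex_intro2 _ _ y0 hy0 Py0).
  move=> wx wy zx zy [z hz zE].
  by have := min z hz; rewrite /sqnorm zE !mxE.
by exists y => //; split; rewrite yE !mxE.
Qed.

Lemma tube_box (eps : R) (x : R * R * R) : 0 < eps -> eps < pi / 6 ->
  iwasawa_dom x -> tube eps (iwasawa x) ->
  ((`[- eps, eps]%classic `*` `[- (1 / eps), 1 / eps]%classic) `*` `]0, +oo[%classic) x.
Proof.
move=> eps_gt0 eps_lt; case: x => -[t T] a [/= /andP[t1 t2] a0].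
rewrite /tube /mkset -[iwasawa _]/(kna t T a) knaE// !mxE/=.
move=> [/andP[c1 c2] Tb]; rewrite !in_itv/= andbT; split => //; split => /=.
  have pi0 := pi_gt0 R.
  have s1 : sin (t - eps) <= 0.
    rewrite sinB -(pmulr_rle0 _ a0).
    have -> : a * (sin t * cos eps - cos t * sin eps) =
      cos eps * (a * sin t) - sin eps * (a * cos t) by ring.
    by rewrite subr_le0.
  have s2 : 0 <= sin (t + eps).
    rewrite sinD -(pmulr_rge0 _ a0).
    have -> : a * (sin t * cos eps + cos t * sin eps) =
      cos eps * (a * sin t) + sin eps * (a * cos t) by ring.
    by rewrite -[leRHS]opprK oppr_ge0 opprD subr_le0 lerNl; lra.
  (* As [t] is in []-pi, pi]], an angle outside [[-eps, eps]] would put [- (t + eps)] or [t - eps]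
     strictly between 0 and [pi], where the sine is positive. *)
  apply/andP; split; rewrite leNgt; apply/negP => tl.
    have : 0 < sin (- (t + eps)) by apply: sin_gt0_pi; apply/andP; split; lra.
    by rewrite sinN; lra.
  have : 0 < sin (t - eps) by apply: sin_gt0_pi; apply/andP; split; lra.
  by lra.
rewrite -ler_norml; congr (`|_| <= _): Tb.
have a0' : a != 0 by rewrite gt_eqF.
transitivity (T * (cos t ^+ 2 + sin t ^+ 2)); last by rewrite cos2Dsin2 mulr1.
by field.
Qed.

Lemma measurable_tube (eps : R) : measurable (tube eps).
Proof.
have mE i j := @measurable_entry R i j.
have mpos (h : SL2 R -> R) : measurable_fun setT h -> measurable [set g | 0 <= h g].
  move=> mh; rewrite (_ : [set _ | _] = setT `&` h @^-1` `[0, +oo[%classic).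
    exact: mh.
  by rewrite setTI; apply/seteqP; split => g /=; rewrite in_itv/= andbT.
pose h1 g := sin eps * sl2_mx g 0 0 - cos eps * sl2_mx g 1 0.
pose h2 g := cos eps * sl2_mx g 1 0 + sin eps * sl2_mx g 0 0.
pose h3 g := 1 / eps - `|sl2_mx g 0 0 * sl2_mx g 0 1 + sl2_mx g 1 0 * sl2_mx g 1 1|.
rewrite (_ : tube eps = [set g | 0 <= h1 g] `&` [set g | 0 <= h2 g] `&` [set g | 0 <= h3 g]).
  apply: measurableI; first apply: measurableI; apply: mpos.
  - by apply: measurable_funB; apply: measurable_funM.
  - by apply: measurable_funD; apply: measurable_funM.
  - apply: measurable_funB => //; apply: (measurableT_comp (@normr_measurable R setT)).
    by apply: measurable_funD; apply: measurable_funM.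
apply/seteqP; split => g /=; rewrite /tube/= /in_cone /h1 /h2 /h3 !subr_ge0.
  by move=> [/andP[-> c2] ->]; split => //; split => //; lra.
by move=> [[-> c2] ->]; split => //; rewrite andTb; lra.
Qed.

End tube.

(** * Unfolding integrals of invariant functions over a fundamental domain *)

Section unfolding.
Variable R : realType.
Implicit Types g y z : SL2 R.

(** Integer matrices are countable. A number coding no element of [SL2Z] is sent to the identity, so
    repetitions occur. *)
Lemma SL2Z_enum : exists e : nat -> SL2 R,
  (forall n, SL2Z (e n)) /\ (forall y, SL2Z y -> exists n, e n = y).
Proof.
pose A n : set (SL2 R) := [set y | SL2Z y /\
  exists2 m : 'M[int]_2, unpickle n = Some m & sl2_mx y = map_mx intr m].
exists (fun n => xget 1%g (A n)); split=> [n|y hy].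
  by case: xgetP => [y _ []|_] //; exact: SL2Z_one.
have H i j : exists m : int, sl2_mx y i j = m%:~R by apply/intrP/hy.
pose m : 'M[int]_2 := \matrix_(i, j) projT1 (cid (H i j)).
have Ay : A (pickle m) y.
  split => //; exists m; first exact: pickleK.
  by apply/matrixP => i j; rewrite !mxE; case: cid.
exists (pickle m); have [_ [m']] := xgetI 1%g Ay.
rewrite pickleK => -[<-] e.
by apply: sl2_mx_inj; rewrite e; have [_ [m'' ]] := Ay; rewrite pickleK => -[<-].
Qed.

Local Open Scope ereal_scope.
Local Notation mu := (haar (R := R)).

(** The preimage is the translate of [B] by [y], written so that its measurability is immediate. *)
Lemma haar_integral_translate (phi : SL2 R -> \bar R) (B : set (SL2 R)) y :
  measurable_fun setT phi -> (forall g, 0 <= phi g) -> measurable B ->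
  (forall g, phi (g * y)%g = phi g) ->
  \int[mu]_(g in (fun g => g * y^-1)%g @^-1` B) phi g = \int[mu]_(g in B) phi g.
Proof.
move=> mphi phi0 mB inv.
have mBy : measurable ((fun g => g * y^-1)%g @^-1` B).
  by rewrite -[X in measurable X]setTI; exact: measurable_mulr.
rewrite integral_mkcond [RHS]integral_mkcond -(@haar_right_invariant _ y)//.
- apply: eq_integral => g _; rewrite !patchE inv.
  by rewrite -[(g * y)%g \in _]/(_ \in B) mulgK.
- by apply/(measurable_restrictT _ _).1 => //; exact: measurable_funTS.
- by move=> g; rewrite patchE; case: ifP.
Qed.

(** Drop from [F] the null set of points with a second orbit point in [F], and cut the rest by the
    first [n] for which [g * e n] is in [S]. The pieces translated by [e n] lie in [S], are
    disjoint, and carry the same integrals of [phi]. *)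
Lemma fundamental_domain_le (F S : set (SL2 R)) (phi : SL2 R -> \bar R) :
  fundamental_domain F -> measurable S ->
  (forall g, exists2 y, SL2Z y & S (g * y)%g) ->
  measurable_fun setT phi -> (forall g, 0 <= phi g) ->
  (forall g y, SL2Z y -> phi (g * y)%g = phi g) ->
  \int[mu]_(g in F) phi g <= \int[mu]_(g in S) phi g.
Proof.
move=> [mF _ Fnull] mS cover mphi phi0 inv.
have [e [eZ eS]] := SL2Z_enum.
have mtr B y : measurable B -> measurable [set g | B (g * y)%g].
  move=> mB; rewrite -[X in measurable X]setTI; exact: (measurable_mulr y).
pose N n := if e n == 1%g then set0 else F `&` [set g | F (g * e n)%g].
have mN n : measurable (N n).
  by rewrite /N; case: ifP => // _; apply: measurableI => //; exact: mtr.
have N0 : mu (\bigcup_n N n) = 0.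
  apply: measure_negligible; first exact: bigcupT_measurable.
  apply: negligible_bigcup => n; rewrite /N; case: ifPn => [_|/eqP en].
    exact: negligible_set0.
  exact: Fnull.
have mNN : measurable (\bigcup_n N n) by exact: bigcupT_measurable.
rewrite (ge0_negligible_integral mNN mF _ _ N0)//; last exact: measurable_funTS.
set F' := F `\` _.
have mF' : measurable F' by exact: measurableD.
have F'inj g y : SL2Z y -> F' g -> F' (g * y)%g -> y = 1%g.
  move=> hy [Fg Ng] [Fgy _]; apply/eqP/negPn/negP => y1; apply: Ng.
  have [n en] := eS y hy; exists n => //.
  by rewrite /N en (negbTE y1).
pose A n := F' `&` [set g | S (g * e n)%g].
have mA n : measurable (A n) by apply: measurableI => //; exact: mtr.
have F'E : F' = \bigcup_n seqDU A n.
  rewrite -seqDU_bigcup_eq; apply/seteqP; split => [g F'g|g [n _ []]//].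
  have [y hy Sy] := cover g; have [n en] := eS y hy.
  by exists n => //; split => //=; rewrite en.
have mD n : measurable (seqDU A n) by exact: seqDU_measurable.
pose B n := (fun g => g * (e n)^-1)%g @^-1` seqDU A n.
have mB n : measurable (B n) by exact: (mtr _ (e n)^-1%g).
have tB : trivIset setT B.
  (* A common point yields two points of [F'] in one orbit, hence [e i = e j]. As the enumeration
     may repeat, the conclusion comes from the disjointness of the pieces [seqDU A]. *)
  apply/trivIsetP => i j _ _ ij; rewrite -subset0 => g [/= Bi Bj].
  have [F'i _] := subset_seqDU Bi; have [F'j _] := subset_seqDU Bj.
  have eij : (e i * (e j)^-1)%g = 1%g.
    apply: (F'inj (g * (e i)^-1)%g) => //; last by rewrite mulgA mulgVK.
    by apply: SL2Z_mul => //; exact: SL2Z_inv.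
  have eE : e i = e j by apply: (@mulIg _ (e j)^-1%g); rewrite eij mulgV.
  have /trivIsetP /(_ i j I I ij) := trivIset_seqDU A.
  by rewrite -subset0; apply; split; [exact: Bi|rewrite eE; exact: Bj].
have E : \int[mu]_(g in \bigcup_n seqDU A n) phi g =
    \int[mu]_(g in \bigcup_n B n) phi g.
  rewrite ge0_integral_bigcup//; last exact: measurable_funTS.
  rewrite ge0_integral_bigcup//; last exact: measurable_funTS.
  apply: eq_eseriesr => n _; rewrite haar_integral_translate// => g.
  by rewrite inv.
rewrite F'E E; apply: ge0_subset_integral => //.
- exact: bigcupT_measurable.
- exact: measurable_funTS.
- move=> g [n _ Bg].
  by have [_ /=] := subset_seqDU (Bg : seqDU A n (g * (e n)^-1)%g); rewrite mulgVK.
Qed.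

End unfolding.

Theorem mainTheorem7 (R : realType) (eps : R) (eps_gt0 : 0 < eps)
    (eps_lt : eps < pi / 6) (F : set (SL2 R)) (hF : fundamental_domain F)
    (f : SL2 R -> R[i]) (hf : L2_quotient F f) :
  (L2normsq F f <=
   \int[lebesgue_measure]_(t in `[(- eps)%R, eps])
     \int[lebesgue_measure]_(T in `[(- (1 / eps))%R, (1 / eps)%R])
       \int[lebesgue_measure]_(a in `]0%R, +oo[)
         (normsq (f (kna t T a)) * (1 / a))%:E)%E.
Proof.
case: hf => mRe mIm inv _.
pose phi g : \bar R := (normsq (f g))%:E.
have mphi : measurable_fun setT phi by exact: measurable_normsq.
have phi0 g : (0 <= phi g)%E by rewrite lee_fin sqr_ge0.
have mS := measurable_tube eps.
(* The translates of the tube cover the group, so unfolding bounds the norm by the integral over the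
   tube, which is then compared with the box. *)
apply: (@le_trans _ _ (\int[haar (R := R)]_(g in tube eps) phi g)%E).
  apply: (fundamental_domain_le hF mS) => //.
    by move=> g; exact: tube_cover.
  by move=> g y hy; rewrite /phi inv.
have sub : `[- eps, eps]%classic `<=` `](- pi)%R, pi]%classic.
  move=> t /=; rewrite !in_itv/= => /andP[t1 t2].
  by have pi0 := pi_gt0 R; apply/andP; split; lra.
have := @ge0_integral_iwasawa_box R phi _ _ (measurable_itv `[- eps, eps])
  (measurable_itv `[- (1 / eps), 1 / eps]) sub mphi phi0.
under [X in _ = X -> _]eq_integral do under eq_integral do
  under eq_integral do rewrite /phi -EFinM -div1r.
move=> <-.
apply: ge0_integral_haar_le => //.
- by apply: measurableX; first apply: measurableX.
- move=> [[t T] a] [[/= /sub]]; rewrite /= !in_itv/= => ? _.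
  by rewrite andbT => a0; split.
- by move=> x; exact: tube_box.
Qed.
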